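(* Let $n\ge 1$ and let $Y\cup T\in\mathcal{LR}^{(n)}$ with $Y=Y_\mu$ and $T$ a ballot tableau of shape $\lambda/\mu$ and weight $\nu$. Let $V_n$ be the subword of the $n$th row of $T$ consisting of its entries in $[n-1]$, and let $\nu_n$ be the number of entries of $T$ equal to $n$. Then $$\rho_1^{(n)}(Y\cup T)=\chi_n^{\mu_n}\,\bar\phi_{V_n}\,\bar\phi_n^{\nu_n}\,\rho_1^{(n-1)}\big[(Y\cup T)^{(n-1)}\big].$$ In particular, all $|V_n|$ bumping routes of the $\bar\phi_{V_n}$-insertions are pairwise disjoint and terminate in the $n$th row.
   Context: Partitions are identified with Young diagrams (English convention, cell $(i,j)$ in row $i$, column $j$); $[n]=\{1,\dots,n\}$. A semistandard skew tableau of shape $\lambda/\mu$ fills $\lambda\setminus\mu$ with positive integers weakly increasing along rows and strictly increasing down columns. Its reading word is read left to right along rows, from the bottom row to the top. A word is ballot (Yamanouchi) if every suffix contains at least as many $i$'s as $(i+1)$'s for every $i$; a tableau is ballot if its reading word is. $Y_\mu$ denotes the Yamanouchi tableau of shape $\mu$ (row $i$ filled with $i$'s). If $U$ has shape $\lambda/\mu$ and $V$ has shape $\gamma/\lambda$, $U\cup V$ denotes the pair glued along $\lambda$. $\mathcal{LR}^{(n)}$ is the set of pairs $Y_\mu\cup T$ with $T$ ballot of shape $\lambda/\mu$, $\ell(\lambda)\le n$. For such a pair and $0\le i\le n$, $(Y\cup T)^{(i)}$ denotes the pair restricted to its first $i$ rows (an element of $\mathcal{LR}^{(i)}$). Switching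 (Benkart–Sottile–Stroomer): on a pair $U\cup V$, a switch interchanges a letter $u$ of $U$ with a horizontally or vertically adjacent letter $v$ of $V$ lying after it, provided that afterwards both the cells of $U$ and the cells of $V$ still satisfy the semistandard conditions (rows weakly increasing, columns strictly increasing). Performing switches until none is possible yields a pair $S\cup H$ of the same total shape ($S$ inner, $H$ outer), independent of the choices; $\rho_1(U\cup V):=S\cup H$. $\rho_1^{(n)}$ is $\rho_1$ restricted to $\mathcal{LR}^{(n)}$ (it maps $\mathcal{LR}^{(n)}$ to itself), and $\rho_1^{(0)}(\emptyset)=\emptyset$. Internal row insertion: for a tableau $H$ of shape $\gamma/\alpha$, an inner corner is a cell $(i,j)\in\gamma/\alpha$ with $(i-1,j),(i,j-1)\notin\gamma/\alpha$, or an empty cell $(i,\alpha_i+1)$ with $(i-1,\alpha_i+1),(i,\alpha_i)\notin\gamma/\alpha$. When $(i,\alpha_i+1)$ is an inner corner, $\phi_i H$ removes the entry of that cell (the cell joins the inner shape), Schensted row-inserts it into row $i+1$, the bumped entry into row $i+2$, and so on until an entry settles at the end of a row (the sequence of cells involved is the bumping route); if the cell is empty, $\phi_i$ just adjoins it to the inner shape. On pairs, $\bar\phi_i(Y_\alpha\cup H):=Y_{\alpha+e_i}\cup\phi_i(H)$, where $\alpha+e_i$ adds one to the $i$th part (for $i=\ell(\alpha)+1$ this appends a part $1$). For a word $w=w_m\cdots w_1$, $\bar\phi_w:=\bar\phi_{w_m}\circ\cdots\circ\bar\phi_{w_1}$ (so $w_1$ acts first). The operator $\chi_n$ appends one entry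 $n$ at the end of the $n$th row of the outer tableau $H$ of a pair $Y_\alpha\cup H$; $\chi_n^{\mu_n}$ is its $\mu_n$-fold iterate. *)

(* Defs.v *)
From mathcomp Require Import all_boot.
From Stdlib Require Import Relation_Operators.

Set Implicit Arguments.
Unset Strict Implicit.
Unset Printing Implicit Defensive.

(* Rows and columns of cells are numbered from 0, whereas letters and the     *)
(* index i of the operators phi_i and chi_i are numbered from 1, so that the  *)
(* i-th row of the text is the row of index i.-1.                             *)

Definition is_part (s : seq nat) : bool := sorted geq s && (0 \notin s).

(* (alpha, H) stands for the pair Y_alpha \cup H: row r of H is the sequence  *)
(* nth [::] H r, and its first entry lies in column nth 0 alpha r.            *)
Definition ypair : Type := (seq nat * seq (seq nat))%type.

(* A filling of a straight shape by letters coming from two tableaux U and V: *)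
(* (true, x) is a letter x of U, and (false, x) is a letter x of V.           *)
Definition filling : Type := seq (seq (bool * nat)).

(* Y_alpha \cup H as a filling, the letters of Y_alpha having origin b and    *)
(* those of H the other origin.                                               *)
Definition glue (b : bool) (P : ypair) : filling :=
  mkseq (fun r => nseq (nth 0 P.1 r) (b, r.+1)
                  ++ [seq (~~ b, x) | x <- nth [::] P.2 r])
        (size P.2).

Definition cell_of (F : filling) (r c : nat) : option (bool * nat) :=
  onth (nth [::] F r) c.

Definition has_letter (b : bool) (F : filling) (r c x : nat) : Prop :=
  cell_of F r c = Some (b, x).

(* The letters of one origin need not occupy consecutive cells, hence         *)
(* arbitrary pairs of cells of a row or of a column are compared.             *)
Definition semistandard (b : bool) (F : filling) : Prop :=
  (forall r c c' x y, c < c' ->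
     has_letter b F r c x -> has_letter b F r c' y -> x <= y) /\
  (forall r r' c x y, r < r' ->
     has_letter b F r c x -> has_letter b F r' c y -> x < y).

(* H is a semistandard tableau with positive entries, of shape gamma / alpha  *)
(* with gamma the shape of the glued filling. The list H has exactly one row  *)
(* for each part of gamma.                                                    *)
Definition skew_pair (P : ypair) : Prop :=
  [/\ is_part P.1, size P.1 <= size P.2, is_part (shape (glue true P)),
      0 \notin flatten P.2 & semistandard false (glue true P)].

Definition reading_word (H : seq (seq nat)) : seq nat := flatten (rev H).

Definition ballot (w : seq nat) : Prop :=
  forall k i, 0 < i -> count_mem i.+1 (drop k w) <= count_mem i (drop k w).

Definition LR (n : nat) (P : ypair) : Prop :=
  [/\ skew_pair P, size P.2 <= n & ballot (reading_word P.2)].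

Definition restrict (k : nat) (P : ypair) : ypair := (take k P.1, take k P.2).

Definition set_cell (F : filling) (r c : nat) (e : bool * nat) : filling :=
  set_nth [::] F r (set_nth e (nth [::] F r) c e).

Definition switch (F G : filling) : Prop :=
  exists r c r' c' u v,
    [/\ (r', c') = (r, c.+1) \/ (r', c') = (r.+1, c),
        has_letter true F r c u /\ has_letter false F r' c' v,
        G = set_cell (set_cell F r c (false, v)) r' c' (true, u)
      & semistandard true G /\ semistandard false G].

Definition switch_final (F G : filling) : Prop :=
  clos_refl_trans filling switch F G /\ ~ (exists G', switch G G').

(* rho1 P Q says that the maximal sequences of switches starting from the     *)
(* pair P (with U = Y_mu and V = T) all end at Q = S \cup H, and that there   *)
(* is at least one. In the end S consists of the letters of V and H of those  *)
(* of U, whence the change of origin. The form (alpha, H) of Q includes that  *)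
(* S is the Yamanouchi tableau Y_alpha.                                       *)
Definition rho1 (P Q : ypair) : Prop :=
  skew_pair Q /\
  (forall G : filling, switch_final (glue true P) G <-> G = glue false Q).

Definition in_skew (P : ypair) (r c : nat) : bool :=
  nth 0 P.1 r <= c < nth 0 P.1 r + size (nth [::] P.2 r).

(* Schensted insertion of x in rows, the list of the rows of index r, r+1, .. *)
(* of a tableau with inner shape alpha; the second component is the sequence  *)
(* of the cells where a letter is placed.                                     *)
Fixpoint row_insert (alpha : seq nat) (x r : nat) (rows : seq (seq nat)) :
    seq (seq nat) * seq (nat * nat) :=
  if rows is row :: rows' then
    let k := find (fun y => x < y) row in
    let cell := (r, nth 0 alpha r + k) in
    if k < size row then
      let rec := row_insert alpha (nth 0 row k) r.+1 rows' in
      (set_nth 0 row k x :: rec.1, cell :: rec.2)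
    else (rcons row x :: rows', [:: cell])
  else ([:: [:: x]], [:: (r, nth 0 alpha r)]).

(* The cell (r, alpha_r), empty or not, is an inner corner of gamma / alpha.  *)
(* For an empty cell, the last condition is needed for Y_{alpha + e} to make  *)
(* sense; for a nonempty one it follows from the first.                       *)
Definition inner_corner (P : ypair) (r : nat) : bool :=
  let c := nth 0 P.1 r in
  [&& (r == 0) || ~~ in_skew P r.-1 c,
      (c == 0) || ~~ in_skew P r c.-1
    & is_part (incr_nth P.1 r)].

(* \bar\phi_i together with its bumping route; None when it is not defined.   *)
Definition phi_route (i : nat) (P : ypair) :
    option (ypair * seq (nat * nat)) :=
  let r := i.-1 in
  let c := nth 0 P.1 r in
  if (0 < i) && inner_corner P r then
    if nth [::] P.2 r is x :: row then
      let ins := row_insert P.1 x r.+1 (drop r.+1 P.2) in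
      Some (incr_nth P.1 r, take r P.2 ++ row :: ins.1, (r, c) :: ins.2)
    else Some (incr_nth P.1 r, set_nth [::] P.2 r [::], [:: (r, c)])
  else None.

Definition phi (i : nat) (P : ypair) : option ypair :=
  omap fst (phi_route i P).

(* The rightmost letter of w acts first. *)
Definition phi_word (w : seq nat) (P : ypair) : option ypair :=
  foldr (fun i => obind (phi i)) (Some P) w.

(* The bumping routes of the successive insertions in phi_word w P. *)
Fixpoint phi_word_routes (w : seq nat) (P : ypair) : seq (seq (nat * nat)) :=
  if w is i :: w' then
    if obind (phi_route i) (phi_word w' P) is Some (_, route)
    then route :: phi_word_routes w' P
    else phi_word_routes w' P
  else [::].

Definition chi (n : nat) (P : ypair) : ypair :=
  (P.1, set_nth [::] P.2 n.-1 (rcons (nth [::] P.2 n.-1) n)).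

Definition disjoint_routes (s t : seq (nat * nat)) : bool :=
  ~~ has (fun c => c \in s) t.

(* Main.v *)
Require Import Defs.
From mathcomp Require Import all_boot.
From mathcomp Require Import zify.
From Stdlib Require Import Relation_Operators Operators_Properties.

Set Implicit Arguments.
Unset Strict Implicit.
Unset Printing Implicit Defensive.

(** Two switches that are possible at the same time commute, so all maximal
    sequences of switches end at the same filling and it suffices to follow a
    convenient one. Letting the letters of V pass one value after the other
    through the values of U, one exchanges two adjacent horizontal strips each
    time, and the shapes that occur form a grid governed by a min-max local rule
    [tog]; the resulting H is read off the last line of the grid.

    For the recursion, the letters n of U just slide to the end of row n, which
    accounts for chi_n. Prepending a letter x to the last row of T adds one cell
    to the shapes of the right boundary of the grid from line x on, and the local
    rule propagates this to one added cell in every shape of these lines. The row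
    of the added cell moves along the last line exactly as prescribed by
    Schensted bumping, from row x down to row n: this is phi_x. Successive added
    cells stay weakly above each other at every value, whence disjoint routes. *)

(** * Confluence of switching *)

(** The work is done on shapes: semistandardness becomes interlacing of row lengths, so that
    switching, ballotness and insertion turn into linear inequalities with minima and maxima. The
    local rule reflects each row length of the middle shape in the interval that interlacing allows.
    The same two numbers [ze k.+1] and [th k] enter one maximum and one minimum, in consecutive
    rows, so one more cell in an outer shape raises exactly one of them; this is why a single added
    cell stays single. That its row moves by bumping does not follow from the local rule alone: the
    induction also carries that interlacing is tight in the rows between the cell and that of the
    previous line (or the bottom row, on line x). Ballotness, an inequality between three
    consecutive shapes, is inherited by every column of the grid. It makes S a Yamanouchi tableau
    and forces the added cell in column [M] to row x, which is where phi_x starts. *)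

Lemma cell_of_lt F r c e : cell_of F r c = Some e ->
  r < size F /\ c < size (nth [::] F r).
Proof.
rewrite /cell_of => H.
have Hc : c < size (nth [::] F r).
  by rewrite ltnNge; apply/negP => le; move: H; rewrite onth_default.
split=> //; rewrite ltnNge; apply/negP => le.
by move: Hc; rewrite (nth_default _ le).
Qed.

Lemma cell_of_set F r c e r0 c0 d : cell_of F r c = Some d ->
  cell_of (set_cell F r c e) r0 c0 =
  if (r0 == r) && (c0 == c) then Some e else cell_of F r0 c0.
Proof.
move=> /cell_of_lt [Hr Hc]; rewrite /cell_of /set_cell nth_set_nth /=.
case: (r0 =P r) => [->|] //=.
case: (c0 =P c) => [->|] /=.
  by rewrite (onthE) (nth_map e) ?nth_set_nth /= ?eqxx // size_set_nth; lia.
move=> ne.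
have [lt|ge] := ltnP c0 (size (nth [::] F r)).
  rewrite !onthE !(nth_map e) ?nth_set_nth /= //; last by rewrite size_set_nth; lia.
  by case: eqP.
by rewrite !onth_default ?size_set_nth //; lia.
Qed.

Lemma size_set_cell F r c e d : cell_of F r c = Some d ->
  size (set_cell F r c e) = size F.
Proof. by move=> /cell_of_lt [Hr Hc]; rewrite size_set_nth; lia. Qed.

Lemma filling_ext (F G : filling) : size F = size G ->
  (forall r c, cell_of F r c = cell_of G r c) -> F = G.
Proof.
move=> sz H; apply: (@eq_from_nth _ [::]) => // r lt.
have row_le (A B : filling) : (forall r c, cell_of A r c = cell_of B r c) ->
    size (nth [::] A r) <= size (nth [::] B r).
  move=> AB; rewrite leqNgt; apply/negP => lt2.
  have := AB r (size (nth [::] B r)); rewrite {2}/cell_of onth_default //.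
  by rewrite /cell_of onthE (nth_map (true, 0)).
apply: (@eq_from_nth _ (true, 0)) => [|c ltc].
  by apply/eqP; rewrite eqn_leq !row_le.
have := H r c; rewrite /cell_of !onthE !(nth_map (true, 0)) //; first by case.
by apply: leq_trans ltc _; apply: row_le.
Qed.

Local Ltac resolve_cell H :=
  rewrite /has_letter H; repeat (case: ifP => ?); try done; exfalso; lia.

Lemma semistandard_row b F r c x r' c' y : semistandard b F ->
  has_letter b F r c x -> has_letter b F r' c' y -> r = r' -> c < c' -> x <= y.
Proof. by move=> [H _] h1 h2 e lt; apply: H lt h1 _; rewrite e. Qed.

Lemma semistandard_col b F r c x r' c' y : semistandard b F ->
  has_letter b F r c x -> has_letter b F r' c' y -> r < r' -> c = c' -> x < y.
Proof. by move=> [_ H] h1 h2 lt e; apply: H lt h1 _; rewrite e. Qed.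

(* Two switches with a common cell exclude each other, and two switches of
   disjoint pairs of cells commute. *)
Lemma switch_diamond F G1 G2 :
  semistandard true F -> semistandard false F -> switch F G1 -> switch F G2 ->
  G1 = G2 \/ exists H, switch G1 H /\ switch G2 H.
Proof.
move=> ssT ssF.
move=> [r [c [r1 [c1 [u [v [adj [Hu Hv] E1 [T1 F1]]]]]]]].
move=> [s [d [s1 [d1 [p [q [adj' [Hp Hq] E2 [T2 F2]]]]]]]].
have cell1 x y : cell_of G1 x y = if (x == r1) && (y == c1) then Some (true, u)
    else if (x == r) && (y == c) then Some (false, v) else cell_of F x y.
  rewrite E1 (@cell_of_set _ _ _ _ _ _ (false, v)) ?(cell_of_set _ _ _ Hu) //.
  by rewrite Hv; case: ifP.
have cell2 x y : cell_of G2 x y = if (x == s1) && (y == d1) then Some (true, p)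
    else if (x == s) && (y == d) then Some (false, q) else cell_of F x y.
  rewrite E2 (@cell_of_set _ _ _ _ _ _ (false, q)) ?(cell_of_set _ _ _ Hp) //.
  by rewrite Hq; case: ifP.
have n0 : (r == r1) && (c == c1) = false by case: adj => -[]; lia.
have n0' : (s == s1) && (d == d1) = false by case: adj' => -[]; lia.
have n1 : (r == s1) && (c == d1) = false.
  by apply/negP => /andP[/eqP a /eqP b]; move: Hu; rewrite /has_letter a b Hq.
have n2 : (s == r1) && (d == c1) = false.
  by apply/negP => /andP[/eqP a /eqP b]; move: Hp; rewrite /has_letter a b Hv.
have [/andP[/eqP a /eqP b]|n3] := boolP ((r == s) && (c == d)).
  left; subst s d.
  have Eup : u = p by move: Hp; rewrite /has_letter Hu => -[].
  (* A horizontal and a vertical switch of the same letter of U exclude each other: with [v] to the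
     right and [q] below, one result forces [v < q] in a column and the other [q <= v] in a row. *)
  case: adj => -[? ?]; case: adj' => -[? ?]; subst r1 c1 s1 d1.
  - by move: Hq; rewrite E1 E2 /has_letter Hv Eup => -[->].
  - have A : v < q by apply: (F1.2 r r.+1 c); rewrite //; resolve_cell cell1.
    have B : q <= v by apply: (F2.1 r c c.+1); rewrite //; resolve_cell cell2.
    lia.
  - have A : q < v by apply: (F2.2 r r.+1 c); rewrite //; resolve_cell cell2.
    have B : v <= q by apply: (F1.1 r c c.+1); rewrite //; resolve_cell cell1.
    lia.
  - by move: Hq; rewrite E1 E2 /has_letter Hv Eup => -[->].
have [/andP[/eqP a /eqP b]|n4] := boolP ((r1 == s1) && (c1 == d1)).
  exfalso; case: adj => -[e1 e2]; case: adj' => -[e3 e4].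
  - lia.
  - have A : p < u.
      by apply: (@semistandard_col true G1 s d p r1 c1 u); try done; try lia; resolve_cell cell1.
    have B : u <= p.
      by apply: (@semistandard_row true G2 r c u s1 d1 p); try done; try lia; resolve_cell cell2.
    lia.
  - have A : u < p.
      by apply: (@semistandard_col true G2 r c u s1 d1 p); try done; try lia; resolve_cell cell2.
    have B : p <= u.
      by apply: (@semistandard_row true G1 s d p r1 c1 u); try done; try lia; resolve_cell cell1.
    lia.
  - lia.
right; set H := set_cell (set_cell G1 s d (false, q)) s1 d1 (true, p).
have Hp1 : has_letter true G1 s d p by resolve_cell cell1.
have Hq1 : has_letter false G1 s1 d1 q by resolve_cell cell1.
have Hu2 : has_letter true G2 r c u by resolve_cell cell2.
have Hv2 : has_letter false G2 r1 c1 v by resolve_cell cell2.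
have Hq1' : cell_of (set_cell G1 s d (false, q)) s1 d1 = Some (false, q).
  by rewrite (cell_of_set _ _ _ Hp1) Hq1; case: ifP.
have Hv2' : cell_of (set_cell G2 r c (false, v)) r1 c1 = Some (false, v).
  by rewrite (cell_of_set _ _ _ Hu2) Hv2; case: ifP.
have cellH x y : cell_of H x y =
    if (x == r1) && (y == c1) then Some (true, u)
    else if (x == r) && (y == c) then Some (false, v)
    else if (x == s1) && (y == d1) then Some (true, p)
    else if (x == s) && (y == d) then Some (false, q) else cell_of F x y.
  rewrite (cell_of_set _ _ _ Hq1') (cell_of_set _ _ _ Hp1) cell1.
  have k (a a' b b' : nat) : (a == a') && (b == b') = false ->
      (x == a) && (y == b) -> (x == a') && (y == b') = false.
    by move=> ne /andP[/eqP -> /eqP ->].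
  case: (boolP ((x == r1) && (y == c1))) => [h|_].
    by rewrite (k _ _ _ _ (negbTE n4) h) (k _ s _ d _ h) // eq_sym (eq_sym c1).
  case: (boolP ((x == r) && (y == c))) => // h.
  by rewrite (k _ _ _ _ n1 h) (k _ _ _ _ (negbTE n3) h).
have HE : H = set_cell (set_cell G2 r c (false, v)) r1 c1 (true, u).
  have Hv' : cell_of (set_cell F r c (false, v)) r1 c1 = Some (false, v).
    by rewrite (cell_of_set _ _ _ Hu) Hv; case: ifP.
  have Hq' : cell_of (set_cell F s d (false, q)) s1 d1 = Some (false, q).
    by rewrite (cell_of_set _ _ _ Hp) Hq; case: ifP.
  apply: filling_ext => [|x y].
    rewrite (size_set_cell _ Hq1') (size_set_cell _ Hp1) (size_set_cell _ Hv2').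
    rewrite (size_set_cell _ Hu2) E1 E2 (size_set_cell _ Hv').
    by rewrite (size_set_cell _ Hu) (size_set_cell _ Hq') (size_set_cell _ Hp).
  by rewrite cellH (cell_of_set _ _ _ Hv2') (cell_of_set _ _ _ Hu2) cell2.
have ssH : semistandard true H /\ semistandard false H.
  pose inA x y := (x == r) && (y == c) || (x == r1) && (y == c1).
  pose inB x y := (x == s) && (y == d) || (x == s1) && (y == d1).
  have disj x y : inA x y -> inB x y -> False.
    by rewrite /inA /inB; clear -n1 n2 n3 n4; lia.
  have inG1 b x y z : ~~ inB x y -> has_letter b H x y z -> has_letter b G1 x y z.
    rewrite /inB /has_letter cellH cell1 negb_or => /andP[/negbTE -> /negbTE ->].
    by [].
  have inG2 b x y z : ~~ inA x y -> has_letter b H x y z -> has_letter b G2 x y z.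
    rewrite /inA /has_letter cellH cell2 negb_or => /andP[/negbTE -> /negbTE ->].
    by [].
  (* Two letters that meet at most one of the switches already stand like this in [G1] or [G2]; only
     a pair with one letter from each switch is new. *)
  have cases b x y z x' y' z' (C : Prop) :
      has_letter b H x y z -> has_letter b H x' y' z' ->
      (has_letter b G1 x y z -> has_letter b G1 x' y' z' -> C) ->
      (has_letter b G2 x y z -> has_letter b G2 x' y' z' -> C) ->
      (inB x y -> inA x' y' -> C) -> (inA x y -> inB x' y' -> C) -> C.
    move=> h1 h2 K1 K2 K3 K4.
    have [b1|b1] := boolP (inB x y); have [b2|b2] := boolP (inB x' y').
    - by apply: K2; apply: inG2 => //; apply/negP => a; apply: disj a _.
    - have [a2|a2] := boolP (inA x' y'); first exact: K3.
      by apply: K2; apply: inG2 => //; apply/negP => a; apply: disj a _.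
    - have [a1|a1] := boolP (inA x y); first exact: K4.
      by apply: K2; apply: inG2 => //; apply/negP => a; apply: disj a _.
    - by apply: K1; apply: inG1.
  have onT x y z : has_letter true H x y z -> inB x y ->
      [/\ x = s1, y = d1 & z = p].
    move=> h iB; have iA : ~~ inA x y by apply/negP => a; apply: disj a iB.
    move: (inG2 _ _ _ _ iA h) iB; rewrite /has_letter cell2 /inB.
    case: andP => [[/eqP -> /eqP ->] [->] //|_]; rewrite orbF.
    by case: andP.
  have onT' x y z : has_letter true H x y z -> inA x y ->
      [/\ x = r1, y = c1 & z = u].
    move=> h iA; have iB : ~~ inB x y by apply/negP => a; apply: disj iA a.
    move: (inG1 _ _ _ _ iB h) iA; rewrite /has_letter cell1 /inA.
    case: andP => [[/eqP -> /eqP ->] [->] //|_]; rewrite orbF.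
    by case: andP.
  have onF x y z : has_letter false H x y z -> inB x y ->
      [/\ x = s, y = d & z = q].
    move=> h iB; have iA : ~~ inA x y by apply/negP => a; apply: disj a iB.
    move: (inG2 _ _ _ _ iA h) iB; rewrite /has_letter cell2 /inB.
    case: andP => [//|_]; rewrite orbF.
    by case: andP => // -[/eqP -> /eqP ->] [->].
  have onF' x y z : has_letter false H x y z -> inA x y ->
      [/\ x = r, y = c & z = v].
    move=> h iA; have iB : ~~ inB x y by apply/negP => a; apply: disj iA a.
    move: (inG1 _ _ _ _ iB h) iA; rewrite /has_letter cell1 /inA.
    case: andP => [//|_]; rewrite orbF.
    by case: andP => // -[/eqP -> /eqP ->] [->].
  have u1 : has_letter true G1 r1 c1 u by rewrite /has_letter cell1 !eqxx.
  have p2 : has_letter true G2 s1 d1 p by rewrite /has_letter cell2 !eqxx.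
  have v1 : has_letter false G1 r c v by resolve_cell cell1.
  have q2 : has_letter false G2 s d q by resolve_cell cell2.
  clear E1 E2 cell1 cell2 cellH HE n0 n0' n3 n4.
  split; split=> x y.
  - move=> y' z z' lt h1 h2; apply: (cases _ _ _ _ _ _ _ _ h1 h2).
    + by move=> k1 k2; apply: semistandard_row T1 k1 k2 _ _.
    + by move=> k1 k2; apply: semistandard_row T2 k1 k2 _ _.
    (* If both switches have the same direction, the two letters already share a row in [F];
       otherwise they do once the vertical switch alone is performed. For columns it is the
       horizontal switch. *)
    + move=> /(onT _ _ _ h1) [ex ey ->] /(onT' _ _ _ h2) [ex' ey' ->].
      case: adj => -[e1 e2]; case: adj' => -[e3 e4].
      * by apply: (semistandard_row ssT Hp Hu); lia.
      * by apply: (semistandard_row T2 p2 Hu2); lia.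
      * by apply: (semistandard_row T1 Hp1 u1); lia.
      * by apply: (semistandard_row ssT Hp Hu); lia.
    + move=> /(onT' _ _ _ h1) [ex ey ->] /(onT _ _ _ h2) [ex' ey' ->].
      case: adj => -[e1 e2]; case: adj' => -[e3 e4].
      * by apply: (semistandard_row ssT Hu Hp); lia.
      * by apply: (semistandard_row T2 Hu2 p2); lia.
      * by apply: (semistandard_row T1 u1 Hp1); lia.
      * by apply: (semistandard_row ssT Hu Hp); lia.
  - move=> c0 z z' lt h1 h2; apply: (cases _ _ _ _ _ _ _ _ h1 h2).
    + by move=> k1 k2; apply: semistandard_col T1 k1 k2 _ _.
    + by move=> k1 k2; apply: semistandard_col T2 k1 k2 _ _.
    + move=> /(onT _ _ _ h1) [ex ey ->] /(onT' _ _ _ h2) [ex' ey' ->].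
      case: adj => -[e1 e2]; case: adj' => -[e3 e4].
      * by apply: (semistandard_col ssT Hp Hu); lia.
      * by apply: (semistandard_col T1 Hp1 u1); lia.
      * by apply: (semistandard_col T2 p2 Hu2); lia.
      * by apply: (semistandard_col ssT Hp Hu); lia.
    + move=> /(onT' _ _ _ h1) [ex ey ->] /(onT _ _ _ h2) [ex' ey' ->].
      case: adj => -[e1 e2]; case: adj' => -[e3 e4].
      * by apply: (semistandard_col ssT Hu Hp); lia.
      * by apply: (semistandard_col T1 u1 Hp1); lia.
      * by apply: (semistandard_col T2 Hu2 p2); lia.
      * by apply: (semistandard_col ssT Hu Hp); lia.
  - move=> y' z z' lt h1 h2; apply: (cases _ _ _ _ _ _ _ _ h1 h2).
    + by move=> k1 k2; apply: semistandard_row F1 k1 k2 _ _.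
    + by move=> k1 k2; apply: semistandard_row F2 k1 k2 _ _.
    + move=> /(onF _ _ _ h1) [ex ey ->] /(onF' _ _ _ h2) [ex' ey' ->].
      case: adj => -[e1 e2]; case: adj' => -[e3 e4].
      * by apply: (semistandard_row ssF Hq Hv); lia.
      * by apply: (semistandard_row F2 q2 Hv2); lia.
      * by apply: (semistandard_row F1 Hq1 v1); lia.
      * by apply: (semistandard_row ssF Hq Hv); lia.
    + move=> /(onF' _ _ _ h1) [ex ey ->] /(onF _ _ _ h2) [ex' ey' ->].
      case: adj => -[e1 e2]; case: adj' => -[e3 e4].
      * by apply: (semistandard_row ssF Hv Hq); lia.
      * by apply: (semistandard_row F2 Hv2 q2); lia.
      * by apply: (semistandard_row F1 v1 Hq1); lia.
      * by apply: (semistandard_row ssF Hv Hq); lia.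
  - move=> c0 z z' lt h1 h2; apply: (cases _ _ _ _ _ _ _ _ h1 h2).
    + by move=> k1 k2; apply: semistandard_col F1 k1 k2 _ _.
    + by move=> k1 k2; apply: semistandard_col F2 k1 k2 _ _.
    + move=> /(onF _ _ _ h1) [ex ey ->] /(onF' _ _ _ h2) [ex' ey' ->].
      case: adj => -[e1 e2]; case: adj' => -[e3 e4].
      * by apply: (semistandard_col ssF Hq Hv); lia.
      * by apply: (semistandard_col F1 Hq1 v1); lia.
      * by apply: (semistandard_col F2 q2 Hv2); lia.
      * by apply: (semistandard_col ssF Hq Hv); lia.
    + move=> /(onF' _ _ _ h1) [ex ey ->] /(onF _ _ _ h2) [ex' ey' ->].
      case: adj => -[e1 e2]; case: adj' => -[e3 e4].
      * by apply: (semistandard_col ssF Hv Hq); lia.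
      * by apply: (semistandard_col F1 v1 Hq1); lia.
      * by apply: (semistandard_col F2 Hv2 q2); lia.
      * by apply: (semistandard_col ssF Hv Hq); lia.
exists H; split.
- by exists s, d, s1, d1, p, q; split.
- by exists r, c, r1, c1, u, v; split.
Qed.

Definition switches := clos_refl_trans filling switch.

Lemma switches_trans F G H : switches F G -> switches G H -> switches F H.
Proof. exact: rt_trans. Qed.

Lemma switch_switches F G : switch F G -> switches F G.
Proof. exact: rt_step. Qed.

Lemma switch_semistandard F G b : switch F G -> semistandard b G.
Proof.
by move=> [? [? [? [? [? [? [_ _ _ []]]]]]]]; case: b.
Qed.

Lemma switches_semistandard F G : switches F G ->
  (forall b, semistandard b F) -> forall b, semistandard b G.
Proof.
elim=> {F G} [F G /switch_semistandard H _ b|//|F G H _ IH1 _ IH2 /IH1 /IH2 //].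
exact: H.
Qed.

(** The diamond closes with at most one switch on each side, so a first switch can be pushed along a
    given sequence to its final filling. Uniqueness of final fillings follows by induction on the
    other sequence. *)
Lemma switches_strip F F1 G : (forall b, semistandard b F) ->
  switch F F1 -> switches F G -> ~ (exists G', switch G G') -> switches F1 G.
Proof.
move=> ss sw FG nG; have {FG} := clos_rt_rt1n _ _ _ _ FG.
move=> FG; elim: FG ss F1 sw nG => {F G} [F|F F2 G sw2 F2G IH] ss F1 sw nG.
  by case: nG; exists F1.
have [<-|[H [s2 s1]]] := switch_diamond (ss true) (ss false) sw2 sw.
  exact: clos_rt1n_rt.
apply: switches_trans (switch_switches s1) _.
by apply: IH s2 nG => b; apply: switch_semistandard sw2.
Qed.

Lemma switches_normal_unique F G G' : (forall b, semistandard b F) ->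
  switches F G -> ~ (exists H, switch G H) -> switch_final F G' -> G' = G.
Proof.
move=> ss FG nG [FG' nG'].
have {FG'} := clos_rt_rt1n _ _ _ _ FG'.
move=> FG'; elim: FG' ss FG nG' => {F G'} [F|F F2 G' sw _ IH] ss FG nG'.
  have := clos_rt_rt1n _ _ _ _ FG.
  by case=> // H ? sw _; case: nG'; exists H.
apply: IH => //; first by move=> b; apply: switch_semistandard sw.
exact: switches_strip ss sw FG nG.
Qed.

(** * Growth grids *)

(* [hs f g]: the skew shape g / f is a horizontal strip. *)
Definition hs (f g : nat -> nat) := forall k, f k <= g k /\ g k.+1 <= f k.

Lemma hs_anti f g : hs f g -> forall k, g k.+1 <= g k.
Proof. by move=> H k; have := H k; lia. Qed.

Lemma hs_anti_le f g j k : hs f g -> j <= k -> g k <= g j.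
Proof.
move=> H /subnK <-; elim: (k - j) => [|m IH] //.
by rewrite addSn; apply: leq_trans (hs_anti H _) IH.
Qed.

(* The row before row 0 is considered as infinite. *)
Definition capped (th ze : nat -> nat) k :=
  if k is k'.+1 then minn (ze k) (th k') else ze 0.

(* Switching the horizontal strips et / th and ze / et produces the strips
   tog th et ze / th and ze / tog th et ze. *)
Definition tog (th et ze : nat -> nat) k :=
  capped th ze k + maxn (ze k.+1) (th k) - et k.

Section Toggle.

Variables th et ze : nat -> nat.
Hypotheses (te : hs th et) (ez : hs et ze).

(** Interlacing bounds [et k] by the first term, so the truncated subtraction in [tog] is a true
    one. The estimates below use this additive form. *)
Lemma togE k : tog th et ze k + et k = capped th ze k + maxn (ze k.+1) (th k).
Proof.
rewrite /tog /capped; case: k => [|k].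
  by have := ez 0; have := te 0; lia.
by have := ez k.+1; have := te k; have := te k.+1; have := ez k; lia.
Qed.

Lemma hs_tog_l : hs th (tog th et ze).
Proof.
move=> k; have := togE k; have := togE k.+1; rewrite /= /capped.
have := ez k; have := te k; have := ez k.+1; have := te k.+1.
case: k => [|k]; first by lia.
by have := ez k; have := te k; lia.
Qed.

Lemma hs_tog_r : hs (tog th et ze) ze.
Proof.
move=> k; have := togE k; have := togE k.+1; rewrite /= /capped.
have := ez k; have := te k; have := ez k.+1; have := te k.+1.
case: k => [|k]; first by lia.
by have := ez k; have := te k; lia.
Qed.

Definition psum (f : nat -> nat) r := \sum_(k < r) f k.

Lemma psum0 f : psum f 0 = 0.
Proof. by rewrite /psum big_ord0. Qed.

Lemma psumS f r : psum f r.+1 = psum f r + f r.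
Proof. by rewrite /psum big_ord_recr. Qed.

(** The sum telescopes: the maximum in row k and the minimum in row k + 1 have the same arguments
    and add up to [ze k.+1 + th k]; only the last maximum is left over. *)
Lemma psum_tog r :
  psum (tog th et ze) r.+1 + psum et r.+1 =
  psum ze r.+1 + psum th r + maxn (ze r.+1) (th r).
Proof.
elim: r => [|r IH].
  by rewrite !psumS !psum0 /=; have := togE 0; rewrite /capped; lia.
rewrite psumS (psumS et) (psumS ze) (psumS th).
by have := togE r.+1; rewrite /capped; lia.
Qed.

End Toggle.

Lemma eq_tog th et ze th' et' ze' : th =1 th' -> et =1 et' -> ze =1 ze' ->
  tog th et ze =1 tog th' et' ze'.
Proof. by move=> H1 H2 H3 k; rewrite /tog /capped; case: k => [|k]; rewrite ?H1 ?H2 ?H3. Qed.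

(* The letters of the strip f2 / f1 in rows <= r are at most as many as those of
   f1 / f0 in rows < r, stated without subtraction. *)
Definition ballot3 (f0 f1 f2 : nat -> nat) := forall r,
  psum f2 r.+1 + psum f0 r <= psum f1 r.+1 + psum f1 r.

(** After [psum_tog] a bound on [maxn (b2 r.+1) (a1 r)] remains. For the first argument it is
    ballotness of the [b] shapes at [r.+1], for the second ballotness at [r] combined with the local
    rule for [a1 r]. *)
Lemma ballot3_tog a0 b0 b1 b2 (a1 := tog a0 b0 b1) (a2 := tog a1 b1 b2) :
  hs a0 b0 -> hs b0 b1 -> hs b1 b2 -> ballot3 b0 b1 b2 -> ballot3 a0 a1 a2.
Proof.
move=> h1 h2 h3 B r.
have h4 : hs a1 b1 by apply: hs_tog_r.
have := psum_tog h1 h2 r; have := psum_tog h4 h3 r; rewrite -/a1 -/a2.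
have := B r; have := B r.+1; rewrite !psumS.
case: r => [|r]; first by rewrite !psum0; lia.
by have := psum_tog h1 h2 r; rewrite -/a1 !psumS; lia.
Qed.

(* Ballotness forces the letter i + 1 to lie in rows of index at least i. *)
Lemma ballot3_stable (f : nat -> nat -> nat) :
  (forall i, hs (f i) (f i.+1)) ->
  (forall i, ballot3 (f i) (f i.+1) (f i.+2)) ->
  forall i k, k < i -> f i.+1 k = f i k.
Proof.
move=> H B; elim=> [|i IH] // k lt.
have E : psum (f i.+1) i = psum (f i) i.
  by apply: eq_bigr => -[j ltj] _; apply: IH.
have : psum (f i.+2) i.+1 <= psum (f i.+1) i.+1.
  by have := B i i; rewrite E; lia.
have le j : j <= i -> psum (f i.+1) j <= psum (f i.+2) j.
  by move=> _; apply: leq_sum => l _; have [] := H i.+1 l.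
have key j : j <= i.+1 -> psum (f i.+2) j <= psum (f i.+1) j ->
    forall k, k < j -> f i.+2 k = f i.+1 k.
  elim: j => [|j IHj] // lej; rewrite !psumS => le1 l ltl.
  have := le j lej; have [+ _] := H i.+1 j => le2 le3.
  have [->|ne] := eqVneq l j; first by lia.
  by apply: IHj; lia.
by move=> h; apply: key (leqnn _) h k lt.
Qed.

(* [u m] is the shape of the letters of U except the m last values, and [t i]
   is the shape of U and of the letters of V up to i. *)
Fixpoint grid (u t : nat -> nat -> nat) i : nat -> nat -> nat :=
  if i is i'.+1 then
    fix col m := if m is m'.+1
                 then tog (grid u t i' m'.+1) (grid u t i' m') (col m')
                 else t i'.+1
  else u.

Section Grid.

Variables u t : nat -> nat -> nat.
Hypotheses (hu : forall m, hs (u m.+1) (u m)) (ht : forall i, hs (t i) (t i.+1)).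
Hypothesis ut : u 0 =1 t 0.

Lemma grid_t i : grid u t i 0 =1 t i.
Proof. by case: i. Qed.

Lemma gridS i m : grid u t i.+1 m.+1 =
  tog (grid u t i m.+1) (grid u t i m) (grid u t i.+1 m).
Proof. by []. Qed.

Lemma hs_grid i m :
  hs (grid u t i m.+1) (grid u t i m) /\ hs (grid u t i m) (grid u t i.+1 m).
Proof.
elim: i m => [|i IHi] m.
  split; first exact: hu.
  elim: m => [|m IHm]; last by rewrite gridS; apply: hs_tog_l => //; apply: hu.
  by move=> k; rewrite !grid_t; apply: ht.
have V m' : hs (grid u t i m') (grid u t i.+1 m') by case: (IHi m').
have V' m' : hs (grid u t i.+1 m') (grid u t i.+2 m').
  elim: m' => [|m' IHm']; first by move=> k; rewrite !grid_t; apply: ht.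
  rewrite [X in hs _ X]gridS; apply: hs_tog_l => //.
  by rewrite gridS; apply: hs_tog_r => //; case: (IHi m').
split=> //; rewrite gridS; apply: hs_tog_r => //.
by case: (IHi m).
Qed.

Hypothesis bt : forall i, ballot3 (t i) (t i.+1) (t i.+2).

Lemma ballot3_grid m i :
  ballot3 (grid u t i m) (grid u t i.+1 m) (grid u t i.+2 m).
Proof.
elim: m i => [|m IH] i.
  move=> r; have E j : psum (grid u t j 0) =1 psum (t j).
    by move=> k; apply: eq_bigr => l _; rewrite grid_t.
  by rewrite !E; apply: bt.
rewrite (gridS i.+1) (gridS i); apply: ballot3_tog (IH i).
- by case: (hs_grid i m).
- by case: (hs_grid i m).
- by case: (hs_grid i.+1 m).
Qed.

Lemma grid_stable m i k : k < i -> grid u t i.+1 m k = grid u t i m k.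
Proof.
move: i k; apply: ballot3_stable => i; last exact: ballot3_grid.
by case: (hs_grid i m).
Qed.

(** A horizontal strip adds at most one row. Together with [grid_stable] this leaves row i as the
    only place for the letter i in column [M], so that column describes a Yamanouchi tableau. *)
Lemma grid_low M i k : u M =1 (fun=> 0) -> i <= k -> grid u t i M k = 0.
Proof.
move=> uM; elim: i k => [|i IH] k le; first exact: uM.
have := (hs_grid i M).2 k.-1; rewrite prednK; last by lia.
by rewrite (IH k.-1); lia.
Qed.

End Grid.

Lemma eq_grid u t u' t' : (forall m, u m =1 u' m) -> (forall i, t i =1 t' i) ->
  forall i m, grid u t i m =1 grid u' t' i m.
Proof.
move=> eu et; elim=> [|i IHi] // [|m] //; first exact: et.
elim: m => [|m IHm]; rewrite !(gridS u t) !(gridS u' t'); apply: eq_tog => //.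
exact: et.
Qed.

(** Column 1 serves as right boundary for the values of U other than the largest; this separates the
    letters n of U from the rest. *)
Lemma grid_shift u t i m :
  grid u t i m.+1 =1 grid (fun m => u m.+1) (fun i => grid u t i 1) i m.
Proof.
elim: i m => [|i IHi] // m; elim: m => [|m IHm] //.
by rewrite gridS [X in _ =1 X]gridS; apply: eq_tog.
Qed.

(** * Adding a cell to the boundary of a grid *)

(** The row whose term of the local rule grows when [ze] gains a cell in row b: the minimum of row b
    while [ze b < th b.-1], otherwise the maximum of row [b.-1]. *)
Definition route_up (th ze : nat -> nat) b :=
  if b is b'.+1 then if th b' <= ze b then b' else b else b.

Lemma route_up_sum th ze ze' b k : (forall k, ze' k = ze k + (k == b)) ->
  capped th ze' k + maxn (ze' k.+1) (th k) =
  capped th ze k + maxn (ze k.+1) (th k) + (k == route_up th ze b).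
Proof.
case: b => [|b] e; rewrite /capped /route_up.
  by case: k => [|k]; rewrite !e; lia.
have [->|nk] := eqVneq k b.+1; first by rewrite !e; case: ifP; lia.
have [->|nk'] := eqVneq k b; last first.
  by case: k nk nk' => [|k] nk nk'; rewrite !e; case: ifP; lia.
by case: b e {nk} => [|b] e; rewrite !e; case: ifP; lia.
Qed.

Lemma route_down_sum th th' ze a k : (forall k, th' k = th k + (k == a)) ->
  capped th' ze k + maxn (ze k.+1) (th' k) =
  capped th ze k + maxn (ze k.+1) (th k) + (k == a + (th a < ze a.+1)).
Proof.
move=> e; rewrite /capped !e.
have [->|nk] := eqVneq k a.+1; first by rewrite !e; lia.
have [->|nk'] := eqVneq k a; last by case: k nk nk' => [|k] nk nk'; rewrite ?e; lia.
by case: a e {nk} => [|a] e; rewrite ?e; lia.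
Qed.

(** The case of line x, where the previous line has no new cell. The condition [ze k.+1 = et k] says
    that interlacing is tight from row [b] to row [a]; it yields the bump rule and is handed on to
    the next column by the last conclusion. *)
Lemma tog_add_cell th et ze et' ze' b a (r := route_up th ze b) :
  hs th et -> hs et ze -> hs et' ze' ->
  et' =1 et -> (forall k, ze' k = ze k + (k == b)) ->
  (forall k, b <= k < a -> ze k.+1 = et k) -> b < a -> th a = et a ->
  [/\ forall k, tog th et' ze' k = tog th et ze k + (k == r),
      b = r + (tog th et ze r < ze r), r <= a
    & forall k, r <= k < a -> tog th et ze k.+1 = th k].
Proof.
move=> te ez ez' e1 e2 Inv ba tha.
have te' : hs th et' by move=> k; rewrite !e1; apply: te.
have zb : 0 < b -> ze b < et b.-1.
  by case: (b) e2 => [|b'] // e2 _; have := ez' b'; rewrite !e1 !e2 eqxx /=; lia.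
split.
- move=> k; have := togE te ez k; have := togE te' ez' k.
  by have := te k; have := ez k; rewrite e1 (route_up_sum _ _ e2) -/r; lia.
- have := togE te ez r; have := Inv b; have := te b; have := ez b.
  move: zb; rewrite /r /route_up /capped; clear r.
  case: b Inv ba e2 => [|b] Inv ba e2; first by lia.
  case: ifP => cd /=; last by lia.
  case: b Inv ba e2 cd => [|b]; first by lia.
  by have := te b; have := te b.+1; have := ez b.+1; lia.
- by rewrite /r /route_up; case: (b) ba => [|b'] ba; [lia|case: ifP; lia].
- move=> k lek; have := togE te ez k.+1; rewrite /capped.
  have := te k; have := te k.+1; have := ez k; have := ez k.+1.
  have Ik := Inv k; have Ik1 := Inv k.+1.
  have E : k.+1 = a -> th k.+1 = et k.+1 by move=> ->.
  move: lek; rewrite /r /route_up; clear r; case: b Inv ba e2 zb Ik Ik1 => [|b].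
    by lia.
  move=> Inv ba e2 zb Ik Ik1; case: ifP => ? lek; last by lia.
  have [Ekb|ne] := eqVneq k b; last by lia.
  by subst k; lia.
Qed.

(** The case of the later lines, where all three given shapes have grown and [c] obeys the bump rule
    of the previous line. *)
Lemma tog_add_cells th et ze th' et' ze' a b c
    (r := if b == a.+1 then a else route_up th ze b) :
  hs th et -> hs et ze -> hs th' et' -> hs et' ze' ->
  (forall k, th' k = th k + (k == a)) -> (forall k, et' k = et k + (k == c)) ->
  (forall k, ze' k = ze k + (k == b)) ->
  c = a + (th a < et a) -> b <= c -> (forall k, b <= k < c -> ze k.+1 = et k) ->
  [/\ forall k, tog th' et' ze' k = tog th et ze k + (k == r),
      b = r + (tog th et ze r < ze r), r <= a
    & forall k, r <= k < a -> tog th et ze k.+1 = th k].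
Proof.
move=> te ez te' ez' e1 e2 e3 ca bc Inv.
have tea := te a; have eza := ez a.
have zb : 0 < b -> b.-1 != c -> ze b < et b.-1.
  case: (b) e3 => [|b'] // e3 _ /=; have := ez' b'; rewrite !e2 !e3 eqxx /=.
  by case: eqP; lia.
(* Since [b <= c <= a.+1], the cells of [et] and [ze] then both lie in row [a.+1], and the new shape
   takes over the row of the cell of [th]. *)
have [Eb|nb] := eqVneq b a.+1.
  have Er : r = a by rewrite /r Eb eqxx.
  have Ec : c = a.+1 by lia.
  have lta : th a < et a by lia.
  have zb' : ze a.+1 < et a by have := zb; rewrite Eb /= Ec; apply => //; lia.
  rewrite Er; split=> //; last by move=> k; lia.
  + move=> k; have := togE te ez k; have := togE te' ez' k.
    have := te k; have := ez k; rewrite /capped.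
    case: k => [|k]; rewrite !e1 !e2 !e3 Eb Ec; case: (a) Eb Ec lta zb' => [|a'];
    lia.
  + have := togE te ez a; rewrite /capped.
    case: (a) Eb Ec lta zb' => [|a']; last by lia.
    by lia.
have ba : b <= a by lia.
have Er : r = route_up th ze b by rewrite /r (negbTE nb).
have zb' : 0 < b -> ze b < et b.-1 by move=> b0; apply: zb => //; lia.
clear zb; rewrite Er {r Er}.
split.
- move=> k; have := togE te ez k; have := togE te' ez' k.
  (* By tightness the cell of [th] contributes to row [c], where it is cancelled by the cell of
     [et]; only the contribution of the cell of [ze] survives. *)
  have -> : capped th' ze' k + maxn (ze' k.+1) (th' k) =
      capped th ze k + maxn (ze k.+1) (th k) + (k == route_up th ze b) + (k == c).
    rewrite (route_down_sum _ _ e1) (route_up_sum _ _ e3) ca.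
    have := Inv a; have := e3 a.+1; lia.
  by have := te k; have := ez k; rewrite !e2; lia.
- have := togE te ez (route_up th ze b).
  have := Inv b; have := te b; have := ez b.
  move: zb'; rewrite /route_up /capped.
  clear nb; case: b Inv ba e3 bc => [|b] Inv ba e3 bc.
    have [E0|ne] := eqVneq a 0; first by subst a; lia.
    by lia.
  case: ifP => cd /=; last first.
    have [E0|ne] := eqVneq a b.+1; first by subst a; lia.
    by lia.
  case: b Inv ba e3 bc cd => [|b]; first by lia.
  by have := te b; have := te b.+1; have := ez b.+1; lia.
- by rewrite /route_up; case: (b) ba => [|b'] ba; [lia|case: ifP; lia].
- move=> k lek; have := togE te ez k.+1; rewrite /capped.
  have := te k; have := te k.+1; have := ez k; have := ez k.+1.
  have Ik := Inv k; have Ik1 := Inv k.+1.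
  have E : k.+1 = a -> a = c -> th k.+1 = et k.+1 by move=> -> ?; lia.
  move: lek; rewrite /route_up; clear nb; case: b Inv ba e3 bc zb' Ik Ik1 => [|b].
    by lia.
  move=> Inv ba e3 bc zb' Ik Ik1; case: ifP => ? lek; last by lia.
  have [Ekb|ne] := eqVneq k b; last by lia.
  by subst k; lia.
Qed.

Section AddCell.

Variables (u t t' : nat -> nat -> nat) (n x : nat).
Hypotheses (hu : forall m, hs (u m.+1) (u m)) (ht : forall i, hs (t i) (t i.+1)).
Hypotheses (ht' : forall i, hs (t' i) (t' i.+1)) (ut : u 0 =1 t 0).
Hypotheses (n0 : 0 < n) (x0 : 0 < x).
Hypothesis tE : forall i k, t' i k = t i k + ((x <= i) && (k == n.-1)).
Hypothesis tn : forall i k, n <= k -> t i k = 0.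
Hypothesis tx : t x.-1 n.-1 = 0.

Let ut' : u 0 =1 t' 0.
Proof. by move=> k; rewrite tE ut; lia. Qed.

Lemma grid_before i m : i < x -> grid u t' i m =1 grid u t i m.
Proof.
elim: i m => [|i IHi] // m lt.
elim: m => [|m IHm]; first by move=> k; rewrite /= tE leqNgt lt addn0.
by rewrite !gridS; apply: eq_tog => //; apply: IHi; apply: ltnW.
Qed.

Lemma grid_zero i m k : n <= k -> grid u t i m k = 0.
Proof.
move=> le; have : grid u t i m k <= t i k; last by rewrite tn //; lia.
elim: m => [|m IH]; first by rewrite grid_t.
by apply: leq_trans IH; have [] := (hs_grid hu ht ut i m).1 k.
Qed.

(** The cell moves down a row exactly when the strip between columns [m.+1] and [m] meets its row.
    On the last line this strip consists of the copies of one letter of H, and the rule is Schensted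
    bumping. *)
Definition bump_rule (i : nat) (s : nat -> nat) := forall m,
  s m = s m.+1 + (grid u t i m.+1 (s m.+1) < grid u t i m (s m.+1)).

Lemma grid_add_cell i : x <= i -> exists s : nat -> nat,
  [/\ s 0 = n.-1, bump_rule i s
    & forall m k, grid u t' i m k = grid u t i m k + (k == s m)].
Proof.
have H i' m := hs_grid hu ht ut i' m; have H' i' m := hs_grid hu ht' ut' i' m.
move=> /subnK <-; elim: (i - x) => [|d [s [s0 sR sE]]].
  rewrite add0n.
  (* On line x, row [n], empty in all shapes, stands in for the cell of the previous line. Tightness
     holds at the start because [tx] makes row [n.-1] empty one line earlier. *)
  pose s := fix f m := if m is m'.+1 then
     route_up (grid u t x.-1 m'.+1) (grid u t x m') (f m') else n.-1.
  have E := prednK x0; have lx : x.-1 < x by rewrite E.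
  have xS m : grid u t x m.+1 =
      tog (grid u t x.-1 m.+1) (grid u t x.-1 m) (grid u t x m) by rewrite -{1 4}E.
  have xS' m : grid u t' x m.+1 =
      tog (grid u t' x.-1 m.+1) (grid u t' x.-1 m) (grid u t' x m) by rewrite -{1 4}E.
  have step m : s m < n ->
      (forall k, grid u t' x m k = grid u t x m k + (k == s m)) ->
      (forall k, s m <= k < n -> grid u t x m k.+1 = grid u t x.-1 m k) ->
      [/\ forall k, grid u t' x m.+1 k = grid u t x m.+1 k + (k == s m.+1),
        s m = s m.+1 + (grid u t x m.+1 (s m.+1) < grid u t x m (s m.+1)) &
        forall k, s m.+1 <= k < n -> grid u t x m.+1 k.+1 = grid u t x.-1 m.+1 k].
    move=> IH1 IH2 IH3; have h1 := (H x.-1 m).2; have h2 := (H' x.-1 m).2.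
    rewrite E in h1 h2.
    have [|k1 k2 k3 k4] := tog_add_cell (H x.-1 m).1 h1 h2 (grid_before m lx)
      IH2 IH3 IH1; first by rewrite !grid_zero.
    rewrite xS; split=> // k; rewrite -k1 xS'.
    by apply: eq_tog => //; apply: grid_before.
  have inv m : [/\ s m < n, forall k, grid u t' x m k = grid u t x m k + (k == s m)
    & forall k, s m <= k < n -> grid u t x m k.+1 = grid u t x.-1 m k].
    elim: m => [|m [IH1 IH2 IH3]].
      split=> [|k|k lek]; first by rewrite /=; lia.
        by rewrite (grid_t ut') (grid_t ut) tE leqnn.
      rewrite !(grid_t ut) /= in lek *; rewrite tn; last by lia.
      by have -> : k = n.-1 by lia.
    have [k1 k2 k3] := step m IH1 IH2 IH3.
    by split=> //; move: k2 IH1; lia.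
  exists s; split=> // m; last by case: (inv m).
  by have [IH1 IH2 IH3] := inv m; have [] := step m IH1 IH2 IH3.
rewrite addSn; set j := d + x in s0 sR sE *.
pose s' := fix f m := if m is m'.+1 then
   if f m' == (s m'.+1).+1 then s m'.+1 else
   route_up (grid u t j m'.+1) (grid u t j.+1 m') (f m') else n.-1.
(* Weakly above the cell of the previous line and tight in between: just what [tog_add_cells] asks
   for and returns one column further. *)
have inv m : [/\ s' m <= s m,
     forall k, grid u t' j.+1 m k = grid u t j.+1 m k + (k == s' m)
   & forall k, s' m <= k < s m -> grid u t j.+1 m k.+1 = grid u t j m k].
  elim: m => [|m [IH1 IH2 IH3]].
    split=> [|k|k]; rewrite ?s0 //; last by rewrite /=; lia.
    by rewrite (grid_t ut') (grid_t ut) tE (_ : x <= j.+1) //; rewrite /j; lia.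
  have [k1 k2 k3 k4] := tog_add_cells (H j m).1 (H j m).2 (H' j m).1 (H' j m).2
    (sE m.+1) (sE m) IH2 (sR m) IH1 IH3.
  by rewrite !gridS; split.
exists s'; split=> //; last by move=> m; case: (inv m).
move=> m; have [IH1 IH2 IH3] := inv m.
have [k1 k2 k3 k4] := tog_add_cells (H j m).1 (H j m).2 (H' j m).1 (H' j m).2
  (sE m.+1) (sE m) IH2 (sR m) IH1 IH3.
by rewrite gridS.
Qed.

End AddCell.

(** * Lattice paths and their fillings *)

Definition fillf (z : nat -> nat) N (f : nat -> nat -> bool * nat) : filling :=
  mkseq (fun r => mkseq (f r) (z r)) N.

Lemma cell_fillf z N f r c : cell_of (fillf z N f) r c =
  if (r < N) && (c < z r) then Some (f r c) else None.
Proof.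
rewrite /cell_of; have [lt|ge] := ltnP r N; last first.
  by rewrite nth_default ?size_mkseq //= onth_default.
rewrite nth_mkseq //; have [ltc|gec] := ltnP c (z r).
  by rewrite onthE (nth_map (true, 0)) ?size_mkseq // nth_mkseq.
by rewrite onth_default ?size_mkseq.
Qed.

Lemma has_letter_fillf b z N f r c x : has_letter b (fillf z N f) r c x <->
  [/\ r < N, c < z r & f r c = (b, x)].
Proof.
rewrite /has_letter cell_fillf; have [lt|ge] := ltnP r N; last by split=> [|[]].
have [ltc|gec] := ltnP c (z r); last by split=> [|[]].
by split=> [[->]|[_ _ ->]].
Qed.

Lemma fillf_ext z N f g : (forall r c, r < N -> c < z r -> f r c = g r c) ->
  fillf z N f = fillf z N g.
Proof.
move=> H; apply: (@eq_from_nth _ [::]); rewrite ?size_mkseq // => r lt.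
rewrite !nth_mkseq //; apply: (@eq_from_nth _ (true, 0)); rewrite ?size_mkseq //.
by move=> c ltc; rewrite !nth_mkseq // H.
Qed.

Lemma switch_fillf z N f f' r c r' c' u v :
  (r', c') = (r, c.+1) \/ (r', c') = (r.+1, c) ->
  r' < N -> c < z r -> c' < z r' ->
  f r c = (true, u) -> f r' c' = (false, v) ->
  f' r c = (false, v) -> f' r' c' = (true, u) ->
  (forall x y, (x, y) != (r, c) -> (x, y) != (r', c') -> f' x y = f x y) ->
  (forall b, semistandard b (fillf z N f')) -> switch (fillf z N f) (fillf z N f').
Proof.
move=> adj ltN ltc ltc' fr fr' f'r f'r' fE ss; have ltr : r < N by case: adj => -[]; lia.
have h1 : has_letter true (fillf z N f) r c u by apply/has_letter_fillf.
have h2 : has_letter false (fillf z N f) r' c' v by apply/has_letter_fillf.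
have ne : (r' == r) && (c' == c) = false by case: adj => -[]; lia.
exists r, c, r', c', u, v; split=> //.
have h3 : cell_of (set_cell (fillf z N f) r c (false, v)) r' c' = Some (false, v).
  by rewrite (cell_of_set _ _ _ h1) ne.
apply: filling_ext => [|x y].
  by rewrite (size_set_cell _ h3) (size_set_cell _ h1) !size_mkseq.
rewrite (cell_of_set _ _ _ h3) (cell_of_set _ _ _ h1) !cell_fillf.
have [/andP[/eqP -> /eqP ->]|n1] := boolP ((x == r') && (y == c')).
  by rewrite ltN ltc' f'r'.
have [/andP[/eqP -> /eqP ->]|n2] := boolP ((x == r) && (y == c)).
  by rewrite ltr ltc f'r.
by rewrite fE.
Qed.

Section Words.

Variable L : nat -> nat -> nat -> nat.
Hypotheses (hU : forall i j, hs (L i j) (L i j.+1)).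
Hypotheses (hV : forall i j, hs (L i j) (L i.+1 j)).

(* A word in the letters U = true and V = false is a lattice path: i and j
   count the letters V and U, and the k-th step adds a horizontal strip. *)
Fixpoint lett (w : seq bool) i j r c : bool * nat :=
  if w is b :: w' then
    if b then if c < L i j.+1 r then (true, j.+1) else lett w' i j.+1 r c
    else if c < L i.+1 j r then (false, i.+1) else lett w' i.+1 j r c
  else (true, 0).

Definition nV (w : seq bool) := count negb w.
Definition nU (w : seq bool) := count id w.

Lemma word_mono w i j r : L i j r <= L (i + nV w) (j + nU w) r.
Proof.
elim: w i j => [|b w IH] i j; first by rewrite !addn0.
case: b; rewrite /nV /nU /= ?add0n ?add1n !addnS.
- by apply: leq_trans (IH i j.+1); have [] := hU i j r.
- by apply: leq_trans (IH i.+1 j); have [] := hV i j r.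
Qed.

Lemma word_anti w i j r r' : (forall r, L i j r.+1 <= L i j r) -> r <= r' ->
  L (i + nV w) (j + nU w) r' <= L (i + nV w) (j + nU w) r.
Proof.
move=> L0; suff H : forall r, L (i + nV w) (j + nU w) r.+1 <= L (i + nV w) (j + nU w) r.
  by move=> /subnK <-; elim: (r' - r) => //= m; apply: leq_trans; apply: H.
elim: w i j L0 {r r'} => [|b w IH] i j L0 r; first by rewrite !addn0.
by case: b; rewrite /nV /nU /= ?add0n ?add1n !addnS -?addSn; apply: IH;
   apply: hs_anti.
Qed.

Lemma lett_cat w1 w2 i j r c : L i j r <= c ->
  lett (w1 ++ w2) i j r c =
  if c < L (i + nV w1) (j + nU w1) r then lett w1 i j r c
  else lett w2 (i + nV w1) (j + nU w1) r c.
Proof.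
elim: w1 i j => [|b w IH] i j le; first by rewrite /= !addn0 ltnNge le.
case: b; rewrite /nV /nU /= ?add0n ?add1n !addnS -?addSn.
- have [lt|ge] := ltnP; first by rewrite (leq_trans lt) // word_mono.
  by rewrite IH //.
- have [lt|ge] := ltnP; first by rewrite (leq_trans lt) // word_mono.
  by rewrite IH //.
Qed.

Lemma lett_bound w i j r c b x :
  L i j r <= c < L (i + nV w) (j + nU w) r -> lett w i j r c = (b, x) ->
  if b then j < x <= j + nU w else i < x <= i + nV w.
Proof.
elim: w i j => [|b' w IH] i j; first by rewrite !addn0; lia.
case: b'; rewrite /nV /nU /= ?add0n ?add1n !addnS -?addSn => /andP[le lt].
- have [ltc|ge] := ltnP; first by case=> <- <-; lia.
  by move=> /IH; rewrite ge lt => /(_ isT); case: (b); rewrite /nU /nV; lia.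
- have [ltc|ge] := ltnP; first by case=> <- <-; lia.
  by move=> /IH; rewrite ge lt => /(_ isT); case: (b); rewrite /nU /nV; lia.
Qed.

Lemma lett_row w i j r c c' b x y :
  L i j r <= c -> c < c' < L (i + nV w) (j + nU w) r ->
  lett w i j r c = (b, x) -> lett w i j r c' = (b, y) -> x <= y.
Proof.
elim: w i j => [|b' w IH] i j; first by rewrite !addn0; lia.
case: b'; rewrite /nV /nU /= ?add0n ?add1n !addnS -?addSn => le /andP[ltc lt].
- have [l1|g1] := ltnP c; have [l2|g2] := ltnP c'.
  + by case=> <- <- [<-].
  + by case=> <- <- /lett_bound; rewrite g2 lt => /(_ isT); lia.
  + by lia.
  + by apply: IH; rewrite ?ltc.
- have [l1|g1] := ltnP c; have [l2|g2] := ltnP c'.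
  + by case=> <- <- [<-].
  + by case=> <- <- /lett_bound; rewrite g2 lt => /(_ isT); lia.
  + by lia.
  + by apply: IH; rewrite ?ltc.
Qed.

Lemma lett_col w i j r r' c b x y : (forall r, L i j r.+1 <= L i j r) ->
  L i j r <= c -> r < r' -> c < L (i + nV w) (j + nU w) r' ->
  lett w i j r c = (b, x) -> lett w i j r' c = (b, y) -> x < y.
Proof.
elim: w i j => [|b' w IH] i j L0.
  move=> le lt; rewrite !addn0 => lt'.
  suff : L i j r' <= L i j r by lia.
  move: (ltnW lt) => /subnK <-.
  by elim: (r' - r) => //= m; apply: leq_trans; apply: L0.
case: b'; rewrite /nV /nU /= ?add0n ?add1n !addnS -?addSn => le ltr lt.
- have strip : L i j.+1 r' <= L i j r.
    have := hs_anti_le (hU i j) ltr; have := hU i j r; lia.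
  have an : L i j.+1 r' <= L i j.+1 r by have := hU i j r; lia.
  have [l1|g1] := ltnP c; have [l2|g2] := ltnP c (L i j.+1 r').
  + by lia.
  + by case=> <- <- /lett_bound; rewrite g2 lt => /(_ isT); lia.
  + by lia.
  + by apply: IH => //; apply: hs_anti.
- have strip : L i.+1 j r' <= L i j r.
    have := hs_anti_le (hV i j) ltr; have := hV i j r; lia.
  have an : L i.+1 j r' <= L i.+1 j r by have := hV i j r; lia.
  have [l1|g1] := ltnP c; have [l2|g2] := ltnP c (L i.+1 j r').
  + by lia.
  + by case=> <- <- /lett_bound; rewrite g2 lt => /(_ isT); lia.
  + by lia.
  + by apply: IH => //; apply: hs_anti.
Qed.

End Words.

(** * Exchanging two adjacent horizontal strips by switches *)

Section Corner.

Variable L : nat -> nat -> nat -> nat.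
Hypotheses (hU : forall i j, hs (L i j) (L i j.+1)).
Hypotheses (hV : forall i j, hs (L i j) (L i.+1 j)).
Hypothesis L00 : forall r, L 0 0 r = 0.
Variables (z : nat -> nat) (N : nat) (w1 w2 : seq bool).
Let i := nV w1.
Let j := nU w1.
Let th := L i j.
Let et := L i j.+1.
Let ze := L i.+1 j.+1.
Let ka := L i.+1 j.
Hypothesis kaE : ka =1 tog th et ze.
Hypothesis zE : forall r, z r = L (i.+1 + nV w2) (j.+1 + nU w2) r.
Hypothesis zN : forall r, N <= r -> z r = 0.

Let te : hs th et := hU i j.
Let ez : hs et ze := hV i j.+1.
Let tk : hs th ka := hV i j.
Let kz : hs ka ze := hU i.+1 j.

Let ze_z r : ze r <= z r.
Proof. by rewrite zE; apply: word_mono. Qed.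

Let th_anti r r' : r <= r' -> th r' <= th r.
Proof. by move=> le; apply: (@word_anti L hU hV w1 0 0) => // k; rewrite !L00. Qed.

Let ze_anti r r' : r <= r' -> ze r' <= ze r.
Proof. exact: hs_anti_le ez. Qed.

Let z_anti r r' : r <= r' -> z r' <= z r.
Proof. by move=> le; rewrite !zE; apply: word_anti => //; apply: hs_anti ez. Qed.

Definition corner_fun (p : nat -> nat -> bool) r c :=
  if c < th r then lett L w1 0 0 r c
  else if c < ze r then (if p r c then (true, j.+1) else (false, i.+1))
  else lett L w2 i.+1 j.+1 r c.

Definition corner_fill p := fillf z N (corner_fun p).

Lemma corner_fill_ext p q :
  (forall r c, th r <= c < ze r -> p r c = q r c) -> corner_fill p = corner_fill q.
Proof.
move=> H; apply: fillf_ext => r c _ _; rewrite /corner_fun.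
by have [//|ge] := ltnP c; have [lt|//] := ltnP c; rewrite H // ge.
Qed.

(** Between [th] and [ze] each origin has a single value, so rows impose nothing there. A column of
    [ze / th] has at most two cells, and these must not have the same origin. *)
Lemma corner_semistandard p b :
  (forall r c, th r <= c < ze r.+1 -> p r c != p r.+1 c) ->
  semistandard b (corner_fill p).
Proof.
move=> okp.
pose m := if b then j.+1 else i.+1.
have low r c x : c < th r -> lett L w1 0 0 r c = (b, x) -> x < m.
  move=> lt /(@lett_bound L); rewrite L00 lt => /(_ isT).
  by rewrite /m !add0n -/i -/j; case: (b); lia.
have high r c x : ze r <= c < z r -> lett L w2 i.+1 j.+1 r c = (b, x) -> m < x.
  rewrite zE => lt E; have := lett_bound lt E.
  by rewrite /m; case: (b); lia.
have mid p' x : (if p' then (true, j.+1) else (false, i.+1)) = (b, x) -> x = m.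
  by rewrite /m; case: p' => -[<- <-].
split=> [r c c' x y lt|r r' c x y lt].
- move=> /has_letter_fillf [lN l1 f1] /has_letter_fillf [_ l2 f2].
  move: f1 f2; rewrite /corner_fun.
  have := te r; have := ez r.
  have [a1|a1] := ltnP c (th r); have [a2|a2] := ltnP c' (th r); try lia.
  + by move=> _ _; apply: (@lett_row L w1); rewrite ?L00 ?lt.
  + move=> _ _ /(low _ _ _ a1) lx; have [b2|b2] := ltnP c' (ze r).
      by move=> /mid ->; lia.
    by move=> /(high r c'); rewrite b2 l2 => /(_ isT); lia.
  have [b1|b1] := ltnP c (ze r); have [b2|b2] := ltnP c' (ze r); try lia.
  + by move=> _ _ /mid -> /mid ->.
  + by move=> _ _ /mid -> /(high r c'); rewrite b2 l2 => /(_ isT); lia.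
  + by move=> _ _; apply: (@lett_row L w2) => //; rewrite -zE lt.
- move=> /has_letter_fillf [lN l1 f1] /has_letter_fillf [_ l2 f2].
  move: f1 f2; rewrite /corner_fun.
  have := te r; have := ez r; have := te r'; have := ez r'.
  have an1 := th_anti (ltnW lt); have an2 := ze_anti (ltnW lt).
  have [a1|a1] := ltnP c (th r); have [a2|a2] := ltnP c (th r'); try lia.
  + by move=> _ _ _ _; apply: (@lett_col L hU hV w1) => // [k|]; rewrite !L00.
  + move=> _ _ _ _ /(low _ _ _ a1) lx; have [b2|b2] := ltnP c (ze r').
      by move=> /mid ->; lia.
    by move=> /(high r' c); rewrite b2 l2 => /(_ isT); lia.
  have [b1|b1] := ltnP c (ze r); have [b2|b2] := ltnP c (ze r'); try lia.
  + have [Er|nr] := eqVneq r' r.+1.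
      have := okp r c; rewrite a1 -Er b2 => /(_ isT) + _ _ _ _.
      by case: (p r c); case: (p r' c) => // _ [<- _] [].
    have := @ze_anti r.+2 r'; have := ez r.+1; have := te r; lia.
  + by move=> _ _ _ _ /mid -> /(high r' c); rewrite b2 l2 => /(_ isT); lia.
  + move=> _ _ _ _; apply: (@lett_col L hU hV w2) => //; last by rewrite -zE.
    exact: hs_anti ez.
Qed.

Lemma corner_switch (p q : nat -> nat -> bool) r c r' c' :
  (r', c') = (r, c.+1) \/ (r', c') = (r.+1, c) ->
  th r <= c < ze r -> th r' <= c' < ze r' ->
  p r c -> ~~ p r' c' -> ~~ q r c -> q r' c' ->
  (forall x y, th x <= y < ze x -> (x, y) != (r, c) -> (x, y) != (r', c') ->
     q x y = p x y) ->
  (forall r c, th r <= c < ze r.+1 -> q r c != q r.+1 c) ->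
  switches (corner_fill p) (corner_fill q).
Proof.
move=> adj /andP[l1 l2] /andP[l3 l4] p1 p2 q1 q2 qE okq; apply: switch_switches.
have zl := ze_z r; have zl' := ze_z r'.
apply: (@switch_fillf z N _ _ r c r' c' j.+1 i.+1) => //; try lia.
- rewrite ltnNge; apply/negP => /zN; lia.
- by rewrite /corner_fun ltnNge l1 /= l2 p1.
- by rewrite /corner_fun ltnNge l3 /= l4 (negbTE p2).
- by rewrite /corner_fun ltnNge l1 /= l2 (negbTE q1).
- by rewrite /corner_fun ltnNge l3 /= l4 q2.
- move=> x y n1 n2; rewrite /corner_fun.
  by have [//|ge] := ltnP y; have [lt|//] := ltnP y; rewrite qE // ge.
- by move=> b; apply: corner_semistandard.
Qed.

Let p0 r c := c < et r.
Let p1 r c := ~~ (c < ka r).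
(** The state after all vertical switches: columns with two cells are exchanged, the cells alone in
    their column are still as in [p0]. *)
Let pm r c := if c < ze r.+1 then false
  else if (0 < r) && (th r.-1 <= c) then true else p0 r c.

Let refl F : switches F F.
Proof. exact: rt_refl. Qed.

(** A column contains at most one pair of cells one above the other, so one vertical switch per
    column is enough. *)
Lemma corner_vertical C :
  switches (corner_fill p0) (corner_fill (fun r c => if c < C then pm r c else p0 r c)).
Proof.
elim: C => [|C IH]; first exact: refl.
apply: switches_trans IH _.
have [/existsP[[r ltr] /= /andP[l1 l2]]|no] :=
    boolP [exists r : 'I_N, (th r <= C) && (C < ze r.+1)].
  apply: (@corner_switch _ _ r C r.+1 C); rewrite ?ltnn ?ltnSn.
  - by right.
  - by rewrite l1; have := @ze_anti r r.+1; lia.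
  - by rewrite l2 andbT; have := te r; have := te r.+1; lia.
  - by rewrite /p0; have := ez r; lia.
  - by rewrite /p0; have := te r; lia.
  - by rewrite /pm l2.
  - rewrite /pm l1 /= ; have := ez r.+1; have := te r; case: ifP => //; lia.
  - move=> x y /andP[m1 m2] n1 n2; have [lt|ge] := ltnP y C.+1; last first.
      by have -> : y < C = false by lia.
    have [//|ge] := ltnP y C; have Ey : y = C by lia.
    subst y; rewrite /pm; case: ifP => [d1|_].
      have [lx|lx|Ex] := ltngtP x r; last by move: n1; rewrite Ex eqxx.
      + have := @ze_anti x.+2 r.+1; have := ez x.+1; have := te x; lia.
      + have := @ze_anti r.+2 x.+1; have := ez r.+1; have := te r; lia.
    case: ifP => // /andP[x0 d1].
    case: x x0 m1 m2 n1 n2 d1 => // x _ m1 m2 n1 n2 d1; rewrite /= in d1.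
    have [lx|lx|Ex] := ltngtP x r; last by move: n2; rewrite Ex eqxx.
    + have := @ze_anti x.+2 r.+1; have := ez x.+1; have := te x; lia.
    + have := @ze_anti r.+2 x.+1; have := ez r.+1; have := te r; lia.
  - move=> x y /andP[m1 m2]; case: ifP => lt.
      rewrite /pm m2 /= m1; have := ez x.+1; have := te x; case: ifP => //; lia.
    by rewrite /p0; have := ez x; have := te x; case: ltnP; case: ltnP; lia.
rewrite (@corner_fill_ext _ (fun r c => if c < C.+1 then pm r c else p0 r c)).
  exact: refl.
move=> x y /andP[m1 m2]; have [lt|ge] := ltnP y C; first by rewrite ltnW // ltnS ltnW.
have [lt|//] := ltnP y C.+1; have Ey : y = C by lia.
have no' r : th r <= C -> C < ze r.+1 -> False.
  move=> a b; have ltr : r < N.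
    by rewrite ltnNge; apply/negP => le; have := zN (leqW le); have := ze_z r.+1; lia.
  by case/existsP: no; exists (Ordinal ltr); rewrite /= a b.
subst y; rewrite /pm; case: ifP => [d1|_]; first by case: (no' x).
case: ifP => // /andP[x0 d1]; case: x x0 m1 m2 d1 => // x _ m1 m2 d1.
by case: (no' x).
Qed.

(** The cells of row K alone in their column form the interval from [a] to [h], with [n1] letters of
    U followed by [n2] letters of V. Moving the latter to the front gives [a + h - et K]: this is
    where the reflection in [tog] comes from. *)
Lemma corner_row K :
  switches (corner_fill (fun r c => if r < K then p1 r c else pm r c))
           (corner_fill (fun r c => if r < K.+1 then p1 r c else pm r c)).
Proof.
set pK := fun r c => if r < K then p1 r c else pm r c.
pose a := maxn (ze K.+1) (th K); pose h := capped th ze K.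
have [ae eh] : a <= et K /\ et K <= h.
  rewrite /a /h /capped; have := te K; have := ez K.
  by case: (K) => [|k]; [lia|have := te k; lia].
pose n1 := et K - a; pose n2 := h - et K.
have kK : ka K = a + n2.
  by have := kaE K; have := togE te ez K; rewrite -/a -/h /n2; lia.
have hK : h <= ze K by rewrite /h /capped; case: (K) => [|k]; lia.
have h_th k : K = k.+1 -> h <= th k by move=> E; rewrite /h /capped E; lia.
have aK : th K <= a by rewrite /a; lia.
have aK' : ze K.+1 <= a by rewrite /a; lia.
(* In [q'] the first [T] letters of V have passed the whole block of U; in [q] the next one stands
   inside the block, with [k] letters of U still on its left. *)
pose q' T r c := if (r == K) && (a <= c < h) then a + T <= c < a + T + n1
  else pK r c.
pose q T k r c := if (r == K) && (a <= c < h)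
  then (a + T <= c <= a + T + n1) && (c != a + T + k) else pK r c.
have okpK r c : th r <= c < ze r.+1 -> pK r c = false /\ pK r.+1 c = true.
  move=> /andP[l1 l2].
  have e1 : p1 r c = false by rewrite /p1; have := kz r; lia.
  have e2 : p1 r.+1 c = true by rewrite /p1; have := tk r; lia.
  have e3 : pm r c = false by rewrite /pm l2.
  have e4 : pm r.+1 c = true.
    by rewrite /pm /= l1; have := ez r.+1; have := te r; case: ifP => //; lia.
  by rewrite /pK; case: ifP => _; case: ifP => _.
have okq T k r c : th r <= c < ze r.+1 -> q T k r c != q T k r.+1 c.
  move=> lrc; have [e1 e2] := okpK r c lrc; rewrite /q.
  have -> : (r == K) && (a <= c < h) = false.
    by apply/negP => /andP[/eqP E] ; move: lrc; rewrite E; lia.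
  have -> : (r.+1 == K) && (a <= c < h) = false.
    by apply/negP => /andP[/eqP E]; have := h_th r (esym E); lia.
  by rewrite e1 e2.
have inner T k : T < n2 -> k <= n1 -> switches (corner_fill (q T k)) (corner_fill (q T 0)).
  move=> lT; elim: k => [|k IH] lk; first exact: refl.
  apply: switches_trans (IH (ltnW lk)).
  have b1 : a <= a + T + k < h by rewrite /n1 /n2 in lT lk *; lia.
  have b2 : a <= (a + T + k).+1 < h by rewrite /n1 /n2 in lT lk *; lia.
  apply: (@corner_switch _ _ K (a + T + k) K (a + T + k).+1); first by left.
  - by lia.
  - by lia.
  - by rewrite /q eqxx b1 /=; lia.
  - by rewrite /q eqxx b2 /=; lia.
  - by rewrite /q eqxx b1 /=; lia.
  - by rewrite /q eqxx b2 /=; lia.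
  - move=> x y _ m1 m2; rewrite /q; case: (x =P K) => //= Ex.
    rewrite Ex in m1 m2.
    have d1 : y != a + T + k by apply: contra m1 => /eqP ->.
    have d2 : y != (a + T + k).+1 by apply: contra m2 => /eqP ->.
    by case: ifP => // _; rewrite d1 addnS d2.
  - exact: okq.
have outer T : T <= n2 -> switches (corner_fill (q' 0)) (corner_fill (q' T)).
  elim: T => [|T IH] lT; first exact: refl.
  apply: switches_trans (IH (ltnW lT)) _.
  have := inner T n1 lT (leqnn _).
  rewrite (@corner_fill_ext (q T n1) (q' T)); last first.
    by move=> r c _; rewrite /q /q'; case: ifP => // _; lia.
  rewrite (@corner_fill_ext (q T 0) (q' T.+1)) //.
  by move=> r c _; rewrite /q /q'; case: ifP => // _; lia.
have := outer n2 (leqnn _).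
rewrite (@corner_fill_ext (q' 0) pK); last first.
  move=> r c /andP[m1 m2]; rewrite /q'; case: ifP => // /andP[/eqP E /andP[c1 c2]].
  rewrite /pK E ltnn /pm; have -> : c < ze K.+1 = false by lia.
  have -> : (0 < K) && (th K.-1 <= c) = false.
    by case: (K) h_th => // k /(_ k erefl); rewrite /=; lia.
  by rewrite /p0 /n1; lia.
rewrite (@corner_fill_ext (q' n2) (fun r c => if r < K.+1 then p1 r c else pm r c)) //.
move=> r c /andP[m1 m2]; rewrite /q' /pK.
have [E|ne] /= := eqVneq r K; last first.
  by have -> : (r < K.+1) = (r < K) by lia.
rewrite E ltnn ltnSn; rewrite E in m1 m2.
case: ifP => [/andP[c1 c2]|out]; first by rewrite /p1 kK /n1 /n2; lia.
rewrite /pm /p1; have [d|d] := ltnP c (ze K.+1).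
  by have := kz K; lia.
have hc : h <= c by move: out; rewrite /a; lia.
move: m2 hc; rewrite /h /capped; case: (K) => [|k] m2 hc; first by lia.
rewrite /=; have -> : th k <= c by lia.
by have := tk k; lia.
Qed.

Lemma corner_switches :
  switches (fillf z N (lett L (w1 ++ true :: false :: w2) 0 0))
           (fillf z N (lett L (w1 ++ false :: true :: w2) 0 0)).
Proof.
have -> : fillf z N (lett L (w1 ++ true :: false :: w2) 0 0) = corner_fill p0.
  apply: fillf_ext => r c _ _; rewrite lett_cat // ?L00 // !add0n -/i -/j -/th.
  rewrite /corner_fun /= -/et -/ze /p0; case: ifP => // _.
  by have := ez r; case: ltnP => ?; case: ltnP => //; lia.
have -> : fillf z N (lett L (w1 ++ false :: true :: w2) 0 0) = corner_fill p1.
  apply: fillf_ext => r c _ _; rewrite lett_cat // ?L00 // !add0n -/i -/j -/th.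
  rewrite /corner_fun /= -/ka -/ze /p1; case: ifP => // _.
  by have := kz r; case: ltnP => ?; case: ltnP => //; lia.
apply: switches_trans (corner_vertical (z 0)) _.
rewrite (@corner_fill_ext _ (fun r c => if r < 0 then p1 r c else pm r c)); last first.
  by move=> r c /andP[_ lt]; have := ze_z r; have := @z_anti 0 r; case: ifP => //; lia.
rewrite (@corner_fill_ext p1 (fun r c => if r < N then p1 r c else pm r c)); last first.
  move=> r c /andP[_ lt]; case: ltnP => // /zN; have := ze_z r; lia.
elim: N => [|K IH]; first exact: refl.
exact: switches_trans IH (corner_row K).
Qed.

End Corner.

(** * Sorting the word of strips by exchanges *)

Section WordSort.

Variable L : nat -> nat -> nat -> nat.
Hypotheses (hU : forall i j, hs (L i j) (L i j.+1)).
Hypotheses (hV : forall i j, hs (L i j) (L i.+1 j)).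
Hypothesis L00 : forall r, L 0 0 r = 0.
Variables (z : nat -> nat) (N n M : nat).
Hypothesis LE : forall i j, j < M -> L i.+1 j =1 tog (L i j) (L i j.+1) (L i.+1 j.+1).
Hypothesis zE : forall r, z r = L n M r.
Hypothesis zN : forall r, N <= r -> z r = 0.

Lemma block_switches k w1 w2 : nU w1 + k + nU w2 = M -> (nV w1 + nV w2).+1 = n ->
  switches (fillf z N (lett L (w1 ++ nseq k true ++ false :: w2) 0 0))
           (fillf z N (lett L (w1 ++ false :: nseq k true ++ w2) 0 0)).
Proof.
elim: k w1 => [|k IH] w1 eM en; first exact: rt_refl.
apply: switches_trans (_ : switches _ (fillf z N
  (lett L (w1 ++ true :: false :: nseq k true ++ w2) 0 0))) _.
  have := IH (w1 ++ [:: true]); rewrite /nU /nV !count_cat /= -!catA /=; apply.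
  - by move: eM; rewrite /nU; lia.
  - by move: en; rewrite /nV; lia.
apply: corner_switches => //.
- by apply: LE; lia.
- move=> r; rewrite zE /nU /nV !count_cat !count_nseq /=.
  by congr (L _ _ r); move: eM en; rewrite /nU /nV; lia.
Qed.

Lemma word_switches m w1 : nU w1 = 0 -> nV w1 + m = n ->
  switches (fillf z N (lett L (w1 ++ nseq M true ++ nseq m false) 0 0))
           (fillf z N (lett L (w1 ++ nseq m false ++ nseq M true) 0 0)).
Proof.
elim: m w1 => [|m IH] w1 e0 en; first by rewrite cats0; apply: rt_refl.
apply: switches_trans (_ : switches _ (fillf z N
  (lett L (w1 ++ false :: nseq M true ++ nseq m false) 0 0))) _.
  apply: block_switches; rewrite /nU /nV !count_nseq /=; first by move: e0; rewrite /nU; lia.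
  by move: en; rewrite /nV; lia.
have := IH (w1 ++ [:: false]); rewrite -!catA /=; apply.
- by move: e0; rewrite /nU count_cat /=; lia.
- by move: en; rewrite /nV count_cat /=; lia.
Qed.

End WordSort.

Lemma lett_U (L : nat -> nat -> nat -> nat) k i j r c :
  L i j r <= c < L i (j + k) r ->
  exists x, [/\ lett L (nseq k true) i j r c = (true, x), j < x <= j + k,
                c < L i x r & L i x.-1 r <= c].
Proof.
elim: k j => [|k IH] j; first by rewrite addn0; lia.
rewrite addnS -addSn /= => /andP[le lt]; case: ltnP => [l|g].
  by exists j.+1; split=> //; lia.
by have [|x [-> ? ? ?]] := IH j.+1; [lia|exists x; split=> //; lia].
Qed.

Lemma lett_V (L : nat -> nat -> nat -> nat) k i j r c :
  L i j r <= c < L (i + k) j r ->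
  exists x, [/\ lett L (nseq k false) i j r c = (false, x), i < x <= i + k,
                c < L x j r & L x.-1 j r <= c].
Proof.
elim: k i => [|k IH] i; first by rewrite addn0; lia.
rewrite addnS -addSn /= => /andP[le lt]; case: ltnP => [l|g].
  by exists i.+1; split=> //; lia.
by have [|x [-> ? ? ?]] := IH i.+1; [lia|exists x; split=> //; lia].
Qed.

Lemma count_leq_nth s i k : sorted leq s -> k < size s ->
  (nth 0 s k <= i) = (k < count (fun y => y <= i) s).
Proof.
elim: s k => [|y s IH] k //= ys lt.
have ss := path_sorted ys; have all_ge := order_path_min leq_trans ys.
case: (leqP y i) => le /=.
  by case: k lt => [|k] lt /=; [rewrite le|rewrite IH].
have c0 : count (fun y => y <= i) s = 0.
  apply/eqP; rewrite eqn0Ngt -has_count -all_predC.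
  by apply: sub_all all_ge => x /=; lia.
rewrite c0 add0n ltn0; case: k lt => [|k] lt /=; first by lia.
by rewrite IH // c0.
Qed.

Lemma is_partP s : reflect ((forall k, nth 0 s k.+1 <= nth 0 s k) /\ 0 \notin s)
  (is_part s).
Proof.
apply: (iffP andP) => -[H z]; split=> //.
  move=> k; have [lt|ge] := ltnP k.+1 (size s); last by rewrite (nth_default _ ge).
  have := sorted_ltn_nth (fun a b c (h1 : geq b a) (h2 : geq a c) => leq_trans h2 h1)
    0 H.
  by move=> /(_ k k.+1); rewrite !inE lt (ltnW lt); apply.
by case: s H {z} => [|x s] H //=; apply/(pathP 0) => k lt; have := H k; case: k lt.
Qed.

Lemma notin0_nth s k : 0 \notin s -> (0 < nth 0 s k) = (k < size s).
Proof.
move=> z; have [lt|ge] := ltnP k (size s); last by rewrite nth_default.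
by rewrite lt0n; apply: contra z => /eqP <-; apply: mem_nth.
Qed.

Definition rowlen (P : ypair) r := nth 0 P.1 r + size (nth [::] P.2 r).

Definition glue_fun b (P : ypair) r c :=
  if c < nth 0 P.1 r then (b, r.+1)
  else (~~ b, nth 0 (nth [::] P.2 r) (c - nth 0 P.1 r)).

Lemma glueE b P : glue b P = fillf (rowlen P) (size P.2) (glue_fun b P).
Proof.
apply: (@eq_from_nth _ [::]); rewrite ?size_mkseq // => r lt.
rewrite !nth_mkseq //; apply: (@eq_from_nth _ (true, 0)).
  by rewrite size_cat size_nseq size_map size_mkseq.
rewrite size_cat size_nseq size_map => c ltc.
rewrite nth_mkseq // nth_cat size_nseq /glue_fun nth_nseq.
case: ltnP => // ge; rewrite (nth_map 0) //; lia.
Qed.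

Lemma shape_glue b P : shape (glue b P) = mkseq (rowlen P) (size P.2).
Proof.
rewrite glueE /shape /fillf /mkseq -map_comp; apply: eq_map => r /=.
by rewrite size_map size_iota.
Qed.

Lemma semistandard_glue b b' P :
  semistandard b (glue b' P) -> semistandard (~~ b) (glue (~~ b') P).
Proof.
have key r c x : has_letter (~~ b) (glue (~~ b') P) r c x -> has_letter b (glue b' P) r c x.
  rewrite !glueE => /has_letter_fillf [h1 h2 h3]; apply/has_letter_fillf; split=> //.
  move: h3; rewrite /glue_fun; case: ifP => _ [e1 <-]; congr (_, _).
    by move: e1; case: (b); case: (b').
  by move: e1; case: (b); case: (b').
by move=> [H1 H2]; split=> [r c c' x y lt|r r' c x y lt] /key h1 /key h2;
  [apply: H1 lt h1 h2|apply: H2 lt h1 h2].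
Qed.

Lemma semistandard_yam P : is_part P.1 -> semistandard true (glue true P).
Proof.
move=> /is_partP [anti _]; rewrite glueE.
split=> [r c c' x y lt|r r' c x y lt] /has_letter_fillf [_ _ +] /has_letter_fillf [_ _];
  rewrite /glue_fun; do 2 case: ifP => // _.
- by move=> [<-] [<-].
- by move=> [<-] [<-].
Qed.

(** * Ballot tableaux *)

(** The right boundary of the grid: the shapes of Y together with the letters of T up to i. *)
Definition tle (P : ypair) i r :=
  nth 0 P.1 r + count (fun y => y <= i) (nth [::] P.2 r).

Lemma count_leqS i s : count (fun y => y <= i.+1) s =
  count (fun y => y <= i) s + count_mem i.+1 s.
Proof. by elim: s => //= y s ->; lia. Qed.

Lemma count_leq_take s i : sorted leq s ->
  all (fun y => y <= i) (take (count (fun y => y <= i) s) s).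
Proof.
move=> ss; apply/(all_nthP 0) => k; rewrite size_take.
have le := count_size (fun y => y <= i) s.
move=> lt; rewrite nth_take; last by move: lt; case: ifP; lia.
by rewrite count_leq_nth //; move: lt; case: ifP; lia.
Qed.

Lemma count_leq_drop s i : sorted leq s ->
  all (fun y => i < y) (drop (count (fun y => y <= i) s) s).
Proof.
move=> ss; apply/(all_nthP 0) => k; rewrite size_drop => lt.
by rewrite nth_drop ltnNge count_leq_nth //; lia.
Qed.

Section SkewPair.

Variable P : ypair.
Hypothesis skP : skew_pair P.

Lemma skew_inner_anti r : nth 0 P.1 r.+1 <= nth 0 P.1 r.
Proof. by case: skP => /is_partP []. Qed.

Lemma skew_inner0 r : size P.2 <= r -> nth 0 P.1 r = 0.
Proof. by case: skP => _ le _ _ _ le'; rewrite nth_default //; apply: leq_trans le'. Qed.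

Lemma rowlen0 r : size P.2 <= r -> rowlen P r = 0.
Proof. by move=> le; rewrite /rowlen skew_inner0 // nth_default. Qed.

Lemma rowlen_gt0 r : r < size P.2 -> 0 < rowlen P r.
Proof.
case: skP => _ _ /is_partP [_ z0] _ _ lt; move: z0; rewrite shape_glue => z0.
by have := notin0_nth r z0; rewrite size_mkseq lt nth_mkseq.
Qed.

Lemma rowlen_anti r : rowlen P r.+1 <= rowlen P r.
Proof.
have [lt|ge] := ltnP r.+1 (size P.2); last by rewrite rowlen0.
case: skP => _ _ /is_partP [anti _] _ _; move: (anti r); rewrite shape_glue.
by rewrite !nth_mkseq // ltnW.
Qed.

Lemma skew_row_sorted r : sorted leq (nth [::] P.2 r).
Proof.
have [lt|ge] := ltnP r (size P.2); last by rewrite nth_default.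
case: skP => _ _ _ _; rewrite glueE => -[ssr _].
apply/(sortedP 0) => k ltk.
apply: (ssr r (nth 0 P.1 r + k) (nth 0 P.1 r + k.+1)); first by lia.
  apply/has_letter_fillf; split=> //; first by rewrite /rowlen; lia.
  by rewrite /glue_fun ltnNge leq_addr /= addKn.
apply/has_letter_fillf; split=> //; first by rewrite /rowlen; lia.
by rewrite /glue_fun ltnNge leq_addr /= addKn.
Qed.

(** Above the last letter not exceeding i + 1 of row r + 1 stands a cell of Y or, by strictness in
    columns, a letter not exceeding i. *)
Lemma hs_tle i : hs (tle P i) (tle P i.+1).
Proof.
move=> r; split; first by rewrite /tle count_leqS; lia.
rewrite {1}/tle; set c := count _ _.
have [c0|cp] := posnP c; first by rewrite c0 /tle; have := skew_inner_anti r; lia.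
have cs : c <= size (nth [::] P.2 r.+1) by apply: count_size.
have ltr : r.+1 < size P.2.
  by rewrite ltnNge; apply/negP => ge; move: cs; rewrite nth_default //=; lia.
pose d := nth 0 P.1 r.+1 + c.-1.
have dl : d < rowlen P r.+1 by rewrite /d /rowlen; lia.
have dl' : d < rowlen P r := leq_trans dl (rowlen_anti r).
suff : d < tle P i r by rewrite /d; lia.
rewrite /tle; have [lt|ge] := ltnP d (nth 0 P.1 r); first by lia.
have le1 : nth 0 (nth [::] P.2 r.+1) c.-1 <= i.+1.
  by rewrite count_leq_nth ?skew_row_sorted // -/c; lia.
have lt2 : nth 0 (nth [::] P.2 r) (d - nth 0 P.1 r) < nth 0 (nth [::] P.2 r.+1) c.-1.
  case: skP => _ _ _ _; rewrite glueE => -[_ ssc].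
  apply: (ssc r r.+1 d) => //; apply/has_letter_fillf; split=> //; first by lia.
    by rewrite /glue_fun ltnNge ge.
  by rewrite /glue_fun /d ltnNge leq_addr /= addKn.
have : nth 0 (nth [::] P.2 r) (d - nth 0 P.1 r) <= i by lia.
by rewrite count_leq_nth ?skew_row_sorted //; move: dl'; rewrite /rowlen; lia.
Qed.

Lemma skew_row_gt0 r : all (fun y => 0 < y) (nth [::] P.2 r).
Proof.
have [lt|ge] := ltnP r (size P.2); last by rewrite nth_default.
case: skP => _ _ _ z0 _; apply/allP => y yin; rewrite lt0n.
apply: contra z0 => /eqP <-; apply/flattenP; exists (nth [::] P.2 r) => //.
exact: mem_nth.
Qed.

Lemma tle0 r : tle P 0 r = nth 0 P.1 r.
Proof.
rewrite /tle; suff -> : count (fun y => y <= 0) (nth [::] P.2 r) = 0 by rewrite addn0.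
apply/eqP; rewrite eqn0Ngt -has_count -all_predC.
by apply: sub_all (skew_row_gt0 r) => y /=; lia.
Qed.

Lemma tle_out i r : size P.2 <= r -> tle P i r = 0.
Proof. by move=> le; rewrite /tle skew_inner0 // nth_default. Qed.

Lemma count_take_rows v r : psum (fun k => count_mem v (nth [::] P.2 k)) r =
  count_mem v (flatten (rev (take r P.2))).
Proof.
elim: r => [|r IH]; first by rewrite psum0 take0.
rewrite psumS IH; have [lt|ge] := ltnP r (size P.2).
  by rewrite (take_nth [::] lt) rev_rcons /= count_cat addnC.
by rewrite nth_default // addn0 !take_oversize // ltnW.
Qed.

Lemma psum_tleS i r : psum (tle P i.+1) r =
  psum (tle P i) r + psum (fun k => count_mem i.+1 (nth [::] P.2 k)) r.
Proof.
by rewrite /psum -big_split /=; apply: eq_bigr => k _; rewrite /tle count_leqS addnA.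
Qed.

Hypothesis bP : ballot (reading_word P.2).

Lemma ballot3_tle i : ballot3 (tle P i) (tle P i.+1) (tle P i.+2).
Proof.
move=> r; rewrite (psum_tleS i.+1) (psum_tleS i r).
suff : psum (fun k => count_mem i.+2 (nth [::] P.2 k)) r.+1 <=
       psum (fun k => count_mem i.+1 (nth [::] P.2 k)) r by lia.
rewrite !count_take_rows; have [lt|ge] := ltnP r (size P.2); last first.
  rewrite !take_oversize // ?(leqW ge) //.
  by have := bP 0 (ltn0Sn i); rewrite drop0.
set row := nth [::] P.2 r; set k := count (fun y => y <= i.+1) row.
have E : reading_word P.2 =
    flatten (rev (drop r.+1 P.2)) ++ (row ++ flatten (rev (take r P.2))).
  rewrite /reading_word -{1}(cat_take_drop r P.2) (drop_nth [::] lt).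
  by rewrite rev_cat rev_cons flatten_cat -cats1 flatten_cat /= cats0 -catA.
(* This suffix starts in row r just after its letters up to i + 1: it contains every i + 2 of rows
   up to r, but the i + 1 only of the rows before r. *)
have := bP (k + size (flatten (rev (drop r.+1 P.2)))) (ltn0Sn i).
rewrite E -drop_drop drop_size_cat // (take_nth [::] lt) rev_rcons /=.
rewrite drop_cat; have ks : k <= size row by apply: count_size.
have ss : sorted leq row := skew_row_sorted r.
have no v : v <= i.+1 -> count_mem v (drop k row) = 0.
  move=> le; apply/eqP; rewrite eqn0Ngt -has_count -all_predC.
  by apply: sub_all (count_leq_drop i.+1 ss) => y /=; lia.
have all2 : count_mem i.+2 row = count_mem i.+2 (drop k row).
  rewrite -{1}(cat_take_drop k row) count_cat.
  suff -> : count_mem i.+2 (take k row) = 0 by [].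
  apply/eqP; rewrite eqn0Ngt -has_count -all_predC.
  by apply: sub_all (count_leq_take i.+1 ss) => y /=; lia.
rewrite count_cat all2; case: ltnP => [lk|gk].
  by rewrite !count_cat (no i.+1) //; lia.
have -> : k = size row by lia.
by rewrite subnn drop0 drop_size /=.
Qed.

Lemma tle_stable i r : r < i -> tle P i.+1 r = tle P i r.
Proof. by move: i r; apply: ballot3_stable; [apply: hs_tle|apply: ballot3_tle]. Qed.

Lemma ballot_row_le r : all (fun y => y <= r.+1) (nth [::] P.2 r).
Proof.
apply/allP => y yin; rewrite leqNgt; apply/negP => lt.
case: y yin lt => [|y] // yin; rewrite ltnS => lt.
have := tle_stable lt; rewrite /tle count_leqS.
have : 0 < count_mem y.+1 (nth [::] P.2 r) by rewrite -has_count has_pred1.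
by lia.
Qed.

Lemma tle_full n r : size P.2 <= n -> tle P n r = rowlen P r.
Proof.
move=> le; have [lt|ge] := ltnP r (size P.2); last by rewrite tle_out // rowlen0.
rewrite /tle /rowlen; congr (_ + _); apply/eqP; rewrite -all_count.
by apply: sub_all (ballot_row_le r) => y /=; lia.
Qed.

End SkewPair.

(** * The result of switching *)

(* [g j] is the shape of the pair Q once the letters of H above j are deleted. *)
Definition rep N M (g : nat -> nat -> nat) (Q : ypair) : Prop :=
  [/\ is_part Q.1, size Q.2 = N, forall r, nth 0 Q.1 r = g 0 r
    & forall r, r < N ->
      [/\ sorted leq (nth [::] Q.2 r), all (fun y => 0 < y <= M) (nth [::] Q.2 r)
        & forall j, j <= M ->
          g 0 r + count (fun y => y <= j) (nth [::] Q.2 r) = g j r]].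

Lemma eq_sorted_count M s s' : sorted leq s -> sorted leq s' ->
  all (fun y => 0 < y <= M) s -> all (fun y => 0 < y <= M) s' ->
  (forall j, j <= M -> count (fun y => y <= j) s = count (fun y => y <= j) s') ->
  s = s'.
Proof.
move=> ss ss' a a' H; apply: (sorted_eq leq_trans anti_leq ss ss').
have none t v : all (fun y => 0 < y <= M) t -> ~~ (0 < v <= M) -> count_mem v t = 0.
  move=> at_ nv; apply/eqP; rewrite eqn0Ngt -has_count -all_predC.
  apply: sub_all at_ => y yb /=; apply: contra nv => /eqP <- //.
apply/allP => v _ /=; apply/eqP.
have [vb|nv] := boolP (0 < v <= M); last by rewrite !none.
case: v vb => // v /andP[_ vM].
have := H v.+1 vM; have := H v (ltnW vM); rewrite !count_leqS.
by move=> -> /addnI.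
Qed.

Lemma eq_part s s' : is_part s -> is_part s' -> nth 0 s =1 nth 0 s' -> s = s'.
Proof.
move=> /is_partP [_ z] /is_partP [_ z'] H; apply: (@eq_from_nth _ 0) => //.
have le t t' : 0 \notin t -> nth 0 t =1 nth 0 t' -> size t <= size t'.
  move=> zt E; rewrite leqNgt -(notin0_nth _ zt) E nth_default //.
by apply/eqP; rewrite eqn_leq !le // => r; rewrite H.
Qed.

(** A pair is determined by its family of shapes; the final identity thus becomes a comparison of
    last lines of grids. *)
Lemma rep_inj N M g g' Q Q' : rep N M g Q -> rep N M g' Q' ->
  (forall j r, j <= M -> g j r = g' j r) -> Q = Q'.
Proof.
case: Q Q' => [a H] [a' H'] [/= pa sH na rH] [/= pa' sH' na' rH'] E.
congr (_, _); first by apply: eq_part => // r; rewrite na na' E.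
apply: (@eq_from_nth _ [::]); first by rewrite sH sH'.
move=> r; rewrite sH => lt; have [s1 b1 c1] := rH r lt; have [s2 b2 c2] := rH' r lt.
apply: (@eq_sorted_count M) => // j jM.
by have := c1 j jM; have := c2 j jM; rewrite !E //; lia.
Qed.

Lemma fillf_ext2 z z' N f g : (forall r, r < N -> z r = z' r) ->
  (forall r c, r < N -> c < z r -> f r c = g r c) -> fillf z N f = fillf z' N g.
Proof.
move=> Hz H; rewrite (fillf_ext H); apply: (@eq_from_nth _ [::]);
by rewrite ?size_mkseq // => r lt; rewrite !nth_mkseq // Hz.
Qed.

Lemma part_of (f : nat -> nat) n : (forall k, f k.+1 <= f k) ->
  (forall k, n <= k -> f k = 0) -> exists2 s, is_part s & forall r, nth 0 s r = f r.
Proof.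
elim: n f => [|n IH] f anti f0.
  by exists [::] => // r; rewrite nth_nil f0.
have [Ef|fp] := posnP (f 0).
  exists [::] => // r; rewrite nth_nil; elim: r => // r IHr.
  by have := anti r; lia.
have [|k le|s ps sE] := IH (fun k => f k.+1); first by move=> k; apply: anti.
  exact: f0.
exists (f 0 :: s); last by case.
apply/is_partP; split; first by case=> [|k] /=; rewrite ?sE.
by rewrite inE negb_or; move/is_partP: ps => [_ ->]; rewrite andbT; lia.
Qed.

(** Row r of [Y_mu] contains only the letter r + 1, so deleting the [m] largest of the values 1,
    ..., [M] empties the rows from [M - m] on. *)
Definition inner_bd (P : ypair) M m r := if r < M - m then nth 0 P.1 r else 0.

Lemma hs_inner_bd P M m : (forall r, nth 0 P.1 r.+1 <= nth 0 P.1 r) ->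
  hs (inner_bd P M m.+1) (inner_bd P M m).
Proof.
move=> anti r; rewrite /inner_bd; have := anti r.
by case: (ltnP r (M - m.+1)); case: (ltnP r (M - m)); case: (ltnP r.+1 (M - m)); lia.
Qed.

Section Rho.

Variables (P : ypair) (n M : nat).
Hypotheses (skP : skew_pair P) (bP : ballot (reading_word P.2)).
Hypotheses (Pn : size P.2 <= n) (PM : size P.1 <= M).

Let u := inner_bd P M.
Let t := tle P.
Let N := size P.2.
Let z := rowlen P.
(** Lattice paths count the values of U that are present, [grid] counts those removed. *)
Let L i j := grid u t i (M - j).
Let hu m : hs (u m.+1) (u m) := hs_inner_bd M m (skew_inner_anti skP).
Let ht i : hs (t i) (t i.+1) := hs_tle skP i.

Let ut : u 0 =1 t 0.
Proof.
move=> r; rewrite /t tle0 // /u /inner_bd subn0; case: ltnP => // ge.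
by rewrite nth_default //; apply: leq_trans ge.
Qed.

Let bt i : ballot3 (t i) (t i.+1) (t i.+2) := ballot3_tle skP bP i.

Let hU i j : hs (L i j) (L i j.+1).
Proof.
rewrite /L; have [lt|ge] := ltnP j M.
  by rewrite -(subnSK lt); apply: (hs_grid hu ht ut _ _).1.
have -> : M - j.+1 = 0 by lia.
have -> : M - j = 0 by lia.
by move=> k; split=> //; apply: hs_anti (hs_grid hu ht ut i 0).1 k.
Qed.

Let hV i j : hs (L i j) (L i.+1 j).
Proof. exact: (hs_grid hu ht ut _ _).2. Qed.

Let L00 r : L 0 0 r = 0.
Proof. by rewrite /L subn0 /= /u /inner_bd subnn. Qed.

Let LE i j : j < M -> L i.+1 j =1 tog (L i j) (L i j.+1) (L i.+1 j.+1).
Proof. by move=> lt k; rewrite /L -(subnSK lt) gridS. Qed.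

Let L_M i r : L i M r = t i r.
Proof. by rewrite /L subnn (grid_t ut). Qed.

Let zE r : z r = L n M r.
Proof. by rewrite L_M /t tle_full. Qed.

Let L_mono i j j' r : j <= j' -> L i j r <= L i j' r.
Proof.
move=> /subnK <-; elim: (j' - j) => // d IH.
by apply: leq_trans IH _; rewrite addSn; have [] := hU i (d + j) r.
Qed.

Lemma glue_start :
  glue true P = fillf z N (lett L (nseq M true ++ nseq n false) 0 0).
Proof.
rewrite glueE; apply: fillf_ext => r c lt ltc.
rewrite (lett_cat hU hV) ?L00 // /nV /nU !count_nseq /= mul1n mul0n addn0 !add0n.
have L0M : L 0 M r = nth 0 P.1 r by rewrite L_M /t tle0.
rewrite /glue_fun L0M; case: ltnP => [l1|g1].
  have [|x [-> /andP[x0 xM] l2 l3]] := @lett_U L M 0 0 r c.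
    by rewrite L00 add0n L0M.
  congr (_, _); move: l2 l3; rewrite /L /= /u /inner_bd.
  by case: (ltnP r (M - (M - x))) => // a; case: (ltnP r (M - (M - x.-1))); lia.
have [|x [-> /andP[x0 xM] l2 l3]] := @lett_V L n 0 M r c.
  by rewrite L0M g1 add0n -zE.
congr (_, _); move: l2 l3; rewrite !L_M /t /tle.
have ss := skew_row_sorted skP r.
have ks : c - nth 0 P.1 r < size (nth [::] P.2 r) by move: ltc; rewrite /rowlen; lia.
have := count_leq_nth x ss ks; have := count_leq_nth x.-1 ss ks; lia.
Qed.

Let al := L n 0.

Let al_z r : al r <= z r.
Proof. by rewrite zE; apply: L_mono. Qed.

Let hl r k := (lett L (nseq M true) n 0 r (al r + k)).2.

Let hlP r k : k < z r - al r ->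
  [/\ lett L (nseq M true) n 0 r (al r + k) = (true, hl r k), 0 < hl r k <= M &
      forall j, j <= M -> (hl r k <= j) = (al r + k < L n j r)].
Proof.
move=> lt; have [|x [E xb l2 l3]] := @lett_U L M n 0 r (al r + k).
  by rewrite add0n leq_addr -zE; lia.
rewrite /hl E /=; split=> //.
move=> j jM; case: (leqP x j) => [xj|jx].
  by symmetry; apply: leq_trans l2 (L_mono _ _ xj).
by apply/esym/negbTE; rewrite -leqNgt; apply: leq_trans l3; apply: L_mono; lia.
Qed.

Lemma rho1_grid :
  exists Q, rho1 P Q /\ rep N M (fun j => L n j) Q.
Proof.
have al_anti k : al k.+1 <= al k.
  rewrite /al /L subn0; case: (M) => [|m]; apply: hs_anti.
    exact: (hs_grid hu ht ut n 0).1.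
  exact: (hs_grid hu ht ut n m.+1).1.
have [k le|a pa aE] := @part_of al N al_anti.
  by have := al_z k; rewrite /z rowlen0 //; lia.
pose H := mkseq (fun r => mkseq (hl r) (z r - al r)) N.
have HN : size H = N by rewrite size_mkseq.
have Hr r : r < N -> nth [::] H r = mkseq (hl r) (z r - al r).
  by move=> lt; rewrite nth_mkseq.
have Hlen r : r < N -> rowlen (a, H) r = z r.
  by move=> lt; rewrite /rowlen /= aE Hr // size_mkseq; have := al_z r; lia.
have final : glue false (a, H) =
    fillf z N (lett L (nseq n false ++ nseq M true) 0 0).
  rewrite glueE HN; apply: fillf_ext2 => // r c lt ltc; rewrite Hlen // in ltc.
  rewrite (lett_cat hU hV) ?L00 // /nV /nU !count_nseq /= mul1n mul0n addn0 !add0n.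
  rewrite /glue_fun /= aE -/al; case: ltnP => [l1|g1].
    have [|x [-> /andP[x0 xn] l2 l3]] := @lett_V L n 0 0 r c.
      by rewrite L00 add0n -/al l1.
    have uM : grid u t 0 M =1 (fun=> 0) by move=> k; have := L00 k; rewrite /L subn0.
    have rx : r < x.
      rewrite ltnNge; apply/negP => le; move: l2.
      by rewrite /L subn0 (grid_low hu ht ut).
    congr (_, _); have [//|lx] := leqP x r.+1; first by lia.
    have := @grid_stable u t hu ht ut bt M x.-1 r; rewrite prednK //.
    by move: l2 l3; rewrite /L subn0; lia.
  have [|E _ _] := @hlP r (c - al r); first by have := al_z r; lia.
  rewrite subnKC // in E; rewrite E Hr // nth_mkseq //.
  by have := al_z r; lia.
have path : switches (glue true P) (glue false (a, H)).
  rewrite glue_start final.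
  apply: (@word_switches L hU hV L00 z N n M LE zE _ n [::]) => //.
  by move=> r le; rewrite /z rowlen0.
have ssF b : semistandard b (glue true P).
  by case: b; [apply: semistandard_yam; case: skP|case: skP].
have ssG := switches_semistandard path ssF.
(* A switch needs a letter of U to the left of or above a letter of V, but the letters of V now fill
   a partition shape. *)
have norm : ~ (exists G, switch (glue false (a, H)) G).
  case=> G [r [c [r' [c' [x [y [adj [h1 h2] _ _]]]]]]]; move: h1 h2.
  rewrite glueE => /has_letter_fillf [_ _ +] /has_letter_fillf [_ _].
  rewrite /glue_fun /= !aE; case: ltnP => // g1; case: ltnP => // l2.
  by case: adj => -[e1 e2]; move: l2; rewrite e1 e2; have := al_anti r; lia.
exists (a, H); split.
  split; last first.
    move=> G; split=> [|->]; last by split.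
    exact: switches_normal_unique ssF path norm.
  split=> //=.
  - rewrite HN leqNgt -(notin0_nth N) ?aE; last by case/is_partP: pa.
    by have := al_z N; rewrite /z rowlen0 //; lia.
  - rewrite shape_glue /= HN; case: skP => _ _ + _ _; rewrite shape_glue.
    suff -> : mkseq (rowlen (a, H)) N = mkseq (rowlen P) (size P.2) by [].
    by apply/eq_in_map => r; rewrite mem_iota => /andP[_ lt]; apply: Hlen.
  - apply/negP => /flattenP [s /(nthP [::]) [r]]; rewrite HN => lt <-.
    rewrite Hr // => /(nthP 0) [k]; rewrite size_mkseq => ltk.
    by rewrite nth_mkseq // => E; have [_] := hlP ltk; rewrite E.
  - exact: (@semistandard_glue true false _ (ssG true)).
split=> //= r lt; rewrite Hr //.
have sr : sorted leq (mkseq (hl r) (z r - al r)).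
  apply/(sortedP 0) => k; rewrite size_mkseq => ltk; rewrite !nth_mkseq //; last by lia.
  have [_ b1 c1] := hlP (ltnW ltk); have [_ b2 c2] := hlP ltk.
  have b2' : hl r k.+1 <= M by case/andP: b2.
  by rewrite c1 //; have := c2 _ b2'; rewrite leqnn; lia.
split=> //.
  apply/(all_nthP 0) => k; rewrite size_mkseq => ltk; rewrite nth_mkseq //.
  by have [] := hlP ltk.
move=> j jM; set s := mkseq _ _.
have key k : k < z r - al r -> (k < count (fun y => y <= j) s) = (al r + k < L n j r).
  move=> ltk; rewrite -count_leq_nth // ?size_mkseq // nth_mkseq //.
  by have [_ _ ->] := hlP ltk.
have cs : count (fun y => y <= j) s <= z r - al r.
  by rewrite (leq_trans (count_size _ _)) // size_mkseq.
have l1 : al r <= L n j r by apply: L_mono.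
have l2 : L n j r <= z r by rewrite zE; apply: L_mono.
rewrite -/al; have := key (count (fun y => y <= j) s); have := key (L n j r - al r); lia.
Qed.

End Rho.

(** * Internal insertion *)

Lemma find_gt_count s v : sorted leq s ->
  find (fun y => v < y) s = count (fun y => y <= v) s.
Proof.
elim: s => //= y s IH ys; have ss := path_sorted ys.
have all_ge := order_path_min leq_trans ys.
case: (ltnP v y) => [lt|le] /=; last by rewrite IH.
apply/esym/eqP; rewrite ?add0n eqn0Ngt -has_count -all_predC.
by apply: sub_all all_ge => z /=; lia.
Qed.

Lemma set_nth_cat k v (s : seq nat) : k < size s ->
  set_nth 0 s k v = take k s ++ v :: drop k.+1 s.
Proof.
elim: s k => [|y s IH] [|k] //= lt; first by rewrite drop0.
by rewrite IH.
Qed.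

Lemma sorted_bump s v (k := count (fun y => y <= v) s) : sorted leq s ->
  k < size s -> sorted leq (set_nth 0 s k v).
Proof.
move=> ss lt; apply/(sortedP 0) => m; rewrite size_set_nth => ltm.
have ltm' : m.+1 < size s by lia.
have S1 := sortedP 0 ss m ltm'; rewrite !nth_set_nth /=.
have h1 := count_leq_nth v ss ltm'; have h2 := count_leq_nth v ss (ltnW ltm').
by rewrite -/k in h1 h2; case: eqP => e1; case: eqP => e2; lia.
Qed.

Lemma count_bump s v j (k := count (fun y => y <= v) s) : k < size s ->
  count (fun y => y <= j) (set_nth 0 s k v) + (nth 0 s k <= j) =
  count (fun y => y <= j) s + (v <= j).
Proof.
move=> lt; rewrite set_nth_cat // -[in RHS](cat_take_drop k s) (drop_nth 0 lt).
by rewrite !count_cat /=; lia.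
Qed.

Lemma all_set_nth (a : pred nat) s k v : k < size s -> all a s -> a v ->
  all a (set_nth 0 s k v).
Proof.
move=> lt al av; rewrite set_nth_cat // all_cat /= av /=.
move: al; rewrite -[in all a s](cat_take_drop k s) (drop_nth 0 lt) all_cat /=.
by move=> /and3P[-> _ ->].
Qed.

(** A cell of the route in row r is the cell added at the first value [v] for which the added cell
    lies in row r; [v = 0] is the cell joining the inner shape. *)
Definition route_spec M (g : nat -> nat -> nat) (s : nat -> nat)
    (rt : seq (nat * nat)) :=
  forall r c, (r, c) \in rt ->
  exists v, [/\ v <= M, s v = r, c = g v r & forall j, j < v -> s j < r].

Section Phi.

Variables (N n M x : nat) (g g' : nat -> nat -> nat) (s : nat -> nat) (P : ypair).
Hypothesis repP : rep N M g P.
Hypotheses (n0 : 0 < n) (x0 : 0 < x) (nN : n.-1 <= N <= n).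
Hypothesis gN : N < n -> forall j, g j n.-1 = 0.
Hypotheses (s0 : s 0 = x.-1) (sM : s M = n.-1).
Hypothesis sR : forall j, j < M -> s j.+1 = s j + (g j (s j) < g j.+1 (s j)).
Hypothesis gE : forall j r, j <= M -> g' j r = g j r + (r == s j).
Hypothesis g'_anti : forall r, g' 0 r.+1 <= g' 0 r.

Let sz : size P.2 = N. Proof. by case: repP. Qed.
Let al r : nth 0 P.1 r = g 0 r. Proof. by case: repP. Qed.

Let s_mono j j' : j <= j' -> j' <= M -> s j <= s j'.
Proof.
move=> /subnK <-; elim: (j' - j) => // d IH; rewrite addSn => le.
by apply: leq_trans (IH (ltnW le)) _; rewrite (sR le) leq_addr.
Qed.

Let s_le j : j <= M -> s j <= n.-1.
Proof. by move=> le; rewrite -sM; apply: s_mono. Qed.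

Definition good_row r row :=
  [/\ sorted leq row, all (fun y => 0 < y <= M) row
    & forall j, j <= M -> g' 0 r + count (fun y => y <= j) row = g' j r].

Let row_of r : r < n -> [/\ sorted leq (nth [::] P.2 r),
  all (fun y => 0 < y <= M) (nth [::] P.2 r)
  & forall j, j <= M -> g 0 r + count (fun y => y <= j) (nth [::] P.2 r) = g j r].
Proof.
move=> lt; have [lN|ge] := ltnP r N; first by case: repP => _ _ _; apply.
have E : r = n.-1 by lia.
by rewrite nth_default ?sz //; split=> // j _; rewrite E !gN //; lia.
Qed.

(* The value bumped out of row r: the first one after which the added cell
   leaves row r. *)
Let next_val r v : v <= M -> s v = r -> r < n.-1 ->
  exists w, [/\ v < w <= M, s w = r.+1, forall j, j < w -> s j <= r,
    g v r = g w.-1 r & g w.-1 r < g w r].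
Proof.
move=> vM sv lr.
have ex : exists w, (w <= M) && (r < s w) by exists M; rewrite leqnn sM.
case: (ex_minnP ex) => w /andP[wM sw] wmin; exists w.
have low j : j < w -> s j <= r.
  by move=> lt; rewrite leqNgt; apply/negP => l; have := wmin j; rewrite l; lia.
have vw : v < w by rewrite ltnNge; apply/negP => le; have := s_mono le vM; lia.
have eqr j : v <= j -> j < w -> s j = r.
  move=> vj jw; have := low j jw; have := @s_mono v j vj; lia.
have const d : v + d < w -> g v r = g (v + d) r.
  elim: d => [|d IH] lt; first by rewrite addn0.
  rewrite IH; last by lia.
  have := @sR (v + d) ltac:(lia); rewrite -addnS !eqr; try lia.
  have [_ _ c] := @row_of r ltac:(lia).
  have mono := c (v + d); have mono' := c (v + d.+1); move: mono mono'.
  rewrite addnS count_leqS; lia.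
have := @sR w.-1 ltac:(lia); rewrite prednK; last by lia.
rewrite (eqr w.-1); try lia.
move=> E; split=> //; try lia.
by rewrite (const (w.-1 - v)) ?subnKC //; lia.
Qed.

(** The path ends in row [n.-1] and cannot leave it, so by [sR] this row has no letter above [v]:
    the insertion settles there. *)
Let last_val v : v <= M -> s v = n.-1 -> g v n.-1 = g M n.-1.
Proof.
move=> vM sv.
have eqr j : v <= j -> j <= M -> s j = n.-1.
  by move=> vj jM; have := s_le jM; have := s_mono vj jM; lia.
have const d : v + d <= M -> g v n.-1 = g (v + d) n.-1.
  elim: d => [|d IH] lt; first by rewrite addn0.
  rewrite IH; last by lia.
  have := @sR (v + d) ltac:(lia); rewrite -addnS !eqr; try lia.
  have [_ _ c] := @row_of n.-1 ltac:(lia).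
  have mono := c (v + d); have mono' := c (v + d.+1); move: mono mono'.
  rewrite addnS count_leqS; lia.
by rewrite (const (M - v)) subnKC.
Qed.

Lemma row_insert_rep d r v (res := row_insert P.1 v r (drop r P.2)) :
  r + d = n.-1 -> x.-1 < r -> 0 < v <= M -> s v = r -> (forall j, j < v -> s j < r) ->
  [/\ size res.1 = n - r, forall k, k < n - r -> good_row (r + k) (nth [::] res.1 k),
      res.2 != [::] /\ (last (0, 0) res.2).1 = n.-1 & route_spec M g s res.2].
Proof.
rewrite /res {res}; elim: d r v => [|d IH] r v rd xr /andP[v0 vM] sv svm.
  have rn : r = n.-1 by lia.
  have nr : n - r = 1 by lia.
  have [ss al1 cc] := @row_of r ltac:(lia).
  have cv : count (fun y => y <= v) (nth [::] P.2 r) = size (nth [::] P.2 r).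
    have := cc v vM; have := cc M (leqnn M); rewrite rn (last_val vM) ?sv //.
    have -> : count (fun y => y <= M) (nth [::] P.2 n.-1) = size (nth [::] P.2 n.-1).
      by apply/eqP; rewrite -all_count -rn; apply: sub_all al1 => y /=; lia.
    by lia.
  have good : good_row r (rcons (nth [::] P.2 r) v).
    split.
    - apply/(sortedP 0) => k; rewrite size_rcons ltnS => ltk; rewrite !nth_rcons ltk.
      case: ltnP => l2; first exact: (sortedP 0 ss k l2).
      rewrite ifT; last by lia.
      by rewrite count_leq_nth // cv.
    - by rewrite all_rcons v0 vM.
    - move=> j jM; rewrite !gE // s0 -cats1 count_cat /= -(cc j jM).
      have -> : (r == x.-1) = false by lia.
      have -> : (r == s j) = (v <= j).
        apply/eqP/idP => [E|vj]; last first.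
          by have := s_le jM; have := s_mono vj jM; lia.
        by rewrite leqNgt; apply/negP => /svm; lia.
      lia.
  have [lN|gN'] := ltnP r N; last first.
    have E : nth [::] P.2 r = [::] by rewrite nth_default // sz.
    rewrite drop_oversize ?sz //= nr; split=> //.
    + by case=> [|k] // _; rewrite addn0 /= -[[:: v]]/(rcons [::] v) -E.
    + move=> r' c'; rewrite inE => /eqP [-> ->]; exists v; split=> //.
      by rewrite al -(cc v vM) E /= addn0.
  rewrite (drop_nth [::]) ?sz //= drop_oversize ?sz; last by lia.
  rewrite find_gt_count // cv ltnn nr /=; split=> //.
  + by case=> [|k] // _; rewrite addn0.
  + move=> r' c'; rewrite inE => /eqP [-> ->]; exists v; split=> //.
    by rewrite al -(cc v vM) cv.
have lr : r < n.-1 by lia.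
have lN : r < N by lia.
have [w [/andP[vw wM] sw swm gv gw]] := next_val vM sv lr.
have [ss al1 cc] := @row_of r ltac:(lia).
rewrite (drop_nth [::]) ?sz //=; set row := nth [::] P.2 r in ss al1 cc *.
rewrite find_gt_count //; set k := count (fun y => y <= v) row.
(* The row has no letter strictly between [v] and [w], but it contains [w]; hence [w] is the letter
   bumped by [v]. *)
have kE : k = count (fun y => y <= w.-1) row.
  by have := cc v vM; have := cc w.-1; rewrite -gv -/k; lia.
have kl : k < count (fun y => y <= w) row.
  by have := cc w wM; have := cc w.-1; rewrite -kE; lia.
have ks : k < size row by apply: leq_trans kl (count_size _ _).
have kw : nth 0 row k = w.
  have := count_leq_nth w ss ks; have := count_leq_nth w.-1 ss ks.
  by rewrite -kE kl ltnn; lia.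
rewrite ks kw; have [|||||I1 I2 [I3 I4] I5] := IH r.+1 w; try lia.
  by move=> j /swm.
split=> /=.
- by rewrite I1; lia.
- case=> [|m] lm; last by rewrite -addSnnS; apply: I2; lia.
  rewrite addn0 /=; split.
  + exact: sorted_bump.
  + by apply: all_set_nth => //; rewrite v0.
  + move=> j jM; rewrite !gE // s0 -(cc j jM).
    have := @count_bump row v j ks; rewrite -/k kw.
    have -> : (r == x.-1) = false by lia.
    (* Replacing [w] by [v] raises the counts of the row for these j only, which are the values at
       which the added cell lies in row r. *)
    have -> : (r == s j) = (v <= j < w).
      apply/eqP/andP => [E|[vj jw]].
        split; first by rewrite leqNgt; apply/negP => /svm; lia.
        by rewrite ltnNge; apply/negP => wj; have := s_mono wj jM; lia.
      by have := swm j jw; have := s_mono vj jM; lia.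
    lia.
- by split=> //; case: (_.2) I3 I4.
- move=> r' c'; rewrite inE => /orP[/eqP [-> ->]|]; last exact: I5.
  by exists v; split=> //; rewrite al cc.
Qed.

Lemma is_part_incr : is_part (incr_nth P.1 x.-1).
Proof.
have E k : nth 0 (incr_nth P.1 x.-1) k = g' 0 k.
  by rewrite nth_incr_nth al gE // s0 eq_sym addnC.
apply/is_partP; split=> [k|]; first by rewrite !E.
apply/negP => /(nthP 0) [k ltk]; rewrite E => Ek.
have pa : 0 \notin P.1 by case: repP => /is_partP [].
have nk : k != x.-1 by apply/negP => /eqP e; move: Ek; rewrite gE // s0 e eqxx; lia.
have kx : k < x.-1.
  move: ltk; rewrite size_incr_nth; case: (ltnP x.-1) => l1 l2; last by lia.
  by move: Ek; rewrite gE // -al; have := notin0_nth k pa; rewrite l2; lia.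
have : g' 0 x.-1 <= g' 0 k.
  move: (ltnW kx) => /subnK <-; elim: (x.-1 - k) => // d; apply: leq_trans.
  exact: g'_anti.
by rewrite Ek gE // s0 eqxx; lia.
Qed.

Lemma inner_corner_rep : inner_corner P x.-1.
Proof.
rewrite /inner_corner is_part_incr andbT /in_skew !al.
have := g'_anti x.-2; rewrite !gE // s0.
by case: (x.-1) => [|y] /=; rewrite ?eqxx; lia.
Qed.

Lemma phi_rep : exists P' rt, [/\ phi_route x P = Some (P', rt), rep n M g' P',
  (last (0, 0) rt).1 = n.-1 & route_spec M g s rt].
Proof.
rewrite /phi_route x0 inner_corner_rep /=.
have xn : x.-1 <= n.-1 by rewrite -s0; apply: s_le.
have al' r : nth 0 (incr_nth P.1 x.-1) r = g' 0 r.
  by rewrite nth_incr_nth al gE // s0 eq_sym addnC.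
have [ss al1 cc] := @row_of x.-1 ltac:(lia).
case E : (nth [::] P.2 x.-1) => [|b row].
  (* A cell leaving row [x.-1] would need a letter there; in an empty row it stays, so the path is
     constant. *)
  have xE : x.-1 = n.-1.
    apply/eqP; rewrite eqn_leq xn leqNgt; apply/negP => lt.
    have [w [/andP[vw wM] sw swm gv gw]] := next_val (leq0n M) s0 lt.
    by have := cc w wM; have := cc w.-1; rewrite E /=; lia.
  have sj j : j <= M -> s j = n.-1.
    by move=> jM; have := s_le jM; have := s_mono (leq0n j) jM; rewrite s0; lia.
  exists (incr_nth P.1 x.-1, set_nth [::] P.2 x.-1 [::]), [:: (x.-1, nth 0 P.1 x.-1)].
  split=> //.
  - split=> //=; first exact: is_part_incr.
      by rewrite size_set_nth sz; lia.
    move=> r ltr; rewrite nth_set_nth /=; case: eqP => [->|ne].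
      split=> // j jM; rewrite !gE // !sj // -(cc j jM) E /=; lia.
    have [s1 a1 c1] := row_of ltr; split=> // j jM.
    by rewrite !gE // !sj // -(c1 j jM); lia.
  - move=> r c; rewrite inE => /eqP [-> ->]; exists 0; split=> //.
have xN : x.-1 < N.
  by rewrite ltnNge -sz; apply/negP => ge; move: E; rewrite nth_default.
(* For [x = n] the path would be constant and row [x.-1] empty by [last_val]; thus [phi n] merely
   adjoins an empty cell. *)
have lt : x.-1 < n.-1.
  rewrite ltnNge; apply/negP => ge; have e : x.-1 = n.-1 by lia.
  have := last_val (leq0n M); rewrite s0 e => /(_ erefl) eg.
  have := cc M (leqnn M); rewrite -e in eg; rewrite -eg E.
  have -> : count (fun y => y <= M) (b :: row) = size (b :: row).
    by apply/eqP; rewrite -all_count -E; apply: sub_all al1 => y /=; lia.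
  by rewrite /=; lia.
have [w [/andP[vw wM] sw swm gv gw]] := next_val (leq0n M) s0 lt.
(* The first letter of the row is the value at which the added cell leaves it, and is the letter
   that phi removes and inserts below. *)
have bw : b = w.
  have k0 : 0 < size (b :: row) by [].
  rewrite E in ss cc.
  have := count_leq_nth w ss k0; have := count_leq_nth w.-1 ss k0.
  by rewrite /= -/(count _ (b :: row)); have := cc w wM; have := cc w.-1; rewrite /=; lia.
have [|||||I1 I2 [I3 I4] I5] := @row_insert_rep (n.-1 - x) x w; try lia.
  by move=> j /swm; lia.
have xS : x.-1.+1 = x by lia.
rewrite xS bw; set ins := row_insert _ _ _ _ in I1 I2 I3 I4 I5 *.
exists (incr_nth P.1 x.-1, take x.-1 P.2 ++ row :: ins.1),
  ((x.-1, nth 0 P.1 x.-1) :: ins.2); split=> //.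
- split=> //=; first exact: is_part_incr.
    by rewrite size_cat size_take sz xN /= I1; lia.
  move=> r ltr; rewrite nth_cat size_take sz xN.
  have [l1|g1] := ltnP r x.-1.
    rewrite nth_take //; have [s1 a1 c1] := row_of ltr; split=> // j jM.
    have sj : x.-1 <= s j by rewrite -s0; apply: s_mono.
    by rewrite !gE // -(c1 j jM) s0; lia.
  have [re|rx] := eqVneq r x.-1.
    rewrite re subnn /=; rewrite E bw in ss al1 cc; split.
    + exact: path_sorted ss.
    + by move: al1 => /= /andP[].
    + move=> j jM; rewrite !gE // s0 eqxx -(cc j jM) /=.
      have -> : (x.-1 == s j) = (j < w).
        apply/eqP/idP => [e|jw].
          by rewrite ltnNge; apply/negP => wj; have := s_mono wj jM; lia.
        by have := swm j jw; have := s_mono (leq0n j) jM; rewrite s0; lia.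
      lia.
  have -> : r - x.-1 = (r - x).+1 by lia.
  have [|k1 k2 k3] := I2 (r - x); first by lia.
  by rewrite subnKC in k3 *; last by lia; split.
- by move: I3 I4; rewrite /=; case: (ins.2).
- move=> r c; rewrite inE => /orP[/eqP [-> ->]|]; last exact: I5.
  by exists 0; split=> //; rewrite al.
Qed.

End Phi.

(** * The last row *)

Lemma grid_le u t (hu : forall m, hs (u m.+1) (u m)) (ht : forall i, hs (t i) (t i.+1))
  (ut : u 0 =1 t 0) i m m' r : m <= m' -> grid u t i m' r <= grid u t i m r.
Proof.
move=> /subnK <-; elim: (m' - m) => // d; apply: leq_trans.
by rewrite addSn; have [] := (hs_grid hu ht ut i (d + m)).1 r.
Qed.

Lemma phi_word_cat w1 w2 P :
  phi_word (w1 ++ w2) P = obind (phi_word w1) (phi_word w2 P).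
Proof.
rewrite /phi_word foldr_cat; elim: w1 => [|x w1 IH] /=; first by case: foldr.
by rewrite IH; case: (foldr _ _ w2).
Qed.

Lemma phi_word_routes_cat w1 w2 P P' : phi_word w2 P = Some P' ->
  phi_word_routes (w1 ++ w2) P = phi_word_routes w1 P' ++ phi_word_routes w2 P.
Proof.
move=> E; elim: w1 => //= x w1 ->; rewrite phi_word_cat E /=.
by case: obind => [[]|].
Qed.

Lemma phi_word_nseq k n P : phi_word (nseq k n) P = iter k (obind (phi n)) (Some P).
Proof. by elim: k => //= k <-. Qed.

Lemma sorted_split_max n s : sorted leq s -> all (fun y => 0 < y <= n) s ->
  s = [seq y <- s | 0 < y < n] ++ nseq (count_mem n s) n.
Proof.
elim: s => //= y s IH ys /andP[yb sb].
have ss := path_sorted ys; have all_ge := order_path_min leq_trans ys.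
have [Ey|ne] := eqVneq y n; last first.
  by rewrite ifT ?add0n /= -?IH //; lia.
have none : [seq z <- s | 0 < z < n] = [::].
  apply/eqP; rewrite -size_eq0 size_filter eqn0Ngt -has_count -all_predC.
  by apply: sub_all all_ge => z /=; lia.
rewrite ifF; last by lia.
by have := IH ss sb; rewrite none Ey /= => {1}->.
Qed.

Lemma skew_restrict k P : skew_pair P -> skew_pair (restrict k P).
Proof.
move=> skP; have [pa le ps z0 ss] := skP.
have nth_tk (A : Type) (d : A) (s : seq A) r : r < k -> nth d (take k s) r = nth d s r.
  by move=> lt; rewrite nth_take.
have nth_tk0 (A : Type) (d : A) (s : seq A) r : k <= r -> nth d (take k s) r = d.
  by move=> ge; rewrite nth_default // size_take; case: ifP; lia.
have part_tk s : is_part s -> is_part (take k s).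
  move=> /is_partP [anti zs]; apply/is_partP; split=> [r|].
    have [lt|ge] := ltnP r.+1 k; first by rewrite !nth_tk // ltnW.
    by rewrite nth_tk0.
  by apply: contra zs => /mem_take.
have rl r : r < k -> rowlen (restrict k P) r = rowlen P r.
  by move=> lt; rewrite /rowlen /= !nth_tk.
split=> /=.
- exact: part_tk.
- by rewrite !size_take; do 2 case: ifP; lia.
- suff -> : shape (glue true (restrict k P)) = take k (shape (glue true P)).
    exact: part_tk.
  rewrite !shape_glue /=; apply: (@eq_from_nth _ 0).
    by rewrite !(size_take, size_mkseq).
  rewrite size_mkseq => r lt; have ltk : r < k by move: lt; rewrite size_take; case: ifP; lia.
  have ltP : r < size P.2 by move: lt; rewrite size_take; case: ifP; lia.
  by rewrite nth_mkseq // nth_tk // nth_mkseq // rl.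
- by apply: contra z0 => /flattenP [s /mem_take sin zin]; apply/flattenP; exists s.
- have key r c x : has_letter false (glue true (restrict k P)) r c x ->
      has_letter false (glue true P) r c x.
    rewrite !glueE => /has_letter_fillf [/= lr lc E].
    have ltk : r < k by move: lr; rewrite size_take; case: ifP; lia.
    apply/has_letter_fillf; split.
    + by move: lr; rewrite size_take; case: ifP; lia.
    + by rewrite -rl.
    + by move: E; rewrite /glue_fun /= !nth_tk.
  case: ss => H1 H2; split=> [r c c' x y lt|r r' c x y lt] /key h1 /key h2.
    exact: H1 lt h1 h2.
  exact: H2 lt h1 h2.
Qed.

Lemma ballot_restrict k T : ballot (reading_word T) -> ballot (reading_word (take k T)).
Proof.
rewrite /ballot /reading_word => H d i i0.
have E : flatten (rev T) = flatten (rev (drop k T)) ++ flatten (rev (take k T)).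
  by rewrite -{1}(cat_take_drop k T) rev_cat flatten_cat.
have := H (d + size (flatten (rev (drop k T)))) i i0.
by rewrite E -drop_drop drop_size_cat.
Qed.

Lemma iter_chi m n P : iter m.+1 (chi n) P =
  (P.1, set_nth [::] P.2 n.-1 (nth [::] P.2 n.-1 ++ nseq m.+1 n)).
Proof.
elim: m => [|m IH]; first by rewrite /= /chi -cats1.
rewrite iterS IH /chi /= nth_set_nth /= eqxx set_set_nth eqxx; congr (_, set_nth _ _ _ _).
by rewrite -cats1 -catA; congr (_ ++ _);
  rewrite -[n :: nseq m n]/(nseq m.+1 n) -[[:: n]]/(nseq 1 n) -nseqD addn1.
Qed.

(** The disjunction ensures that row [n.-1] is present at the end: either it exists already or the
    first [chi n] creates it. *)
Lemma chi_rep N n m g Q : 0 < n -> n.-1 <= N <= n -> 0 < m \/ N = n ->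
  (N < n -> forall j, g j n.-1 = 0) -> rep N n.-1 g Q ->
  rep n n (fun j r => if j < n then g j r else g n.-1 r + m * (r == n.-1))
    (iter m (chi n) Q).
Proof.
move=> n0 nN mN gN [pa sQ aE rows].
have rows' r : r < n -> [/\ sorted leq (nth [::] Q.2 r),
  all (fun y => 0 < y <= n.-1) (nth [::] Q.2 r)
  & forall j, j <= n.-1 -> g 0 r + count (fun y => y <= j) (nth [::] Q.2 r) = g j r].
  move=> lt; have [lN|ge] := ltnP r N; first exact: rows.
  have E : r = n.-1 by lia.
  by rewrite nth_default ?sQ //; split=> // j _; rewrite E !gN //; lia.
have full r : r < n -> count (fun y => y <= n) (nth [::] Q.2 r) =
    count (fun y => y <= n.-1) (nth [::] Q.2 r).
  move=> /rows' [_ al _]; apply: eq_in_count => y yin /=.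
  by have := allP al y yin; lia.
have base r : r < n -> [/\ sorted leq (nth [::] Q.2 r),
  all (fun y => 0 < y <= n) (nth [::] Q.2 r)
  & forall j, j <= n -> g 0 r + count (fun y => y <= j) (nth [::] Q.2 r) =
     g (minn j n.-1) r].
  move=> lt; have [s1 a1 c1] := rows' r lt; split=> //.
    by apply: sub_all a1 => y; lia.
  move=> j jn; have [ltj|gej] := leqP j n.-1; first by rewrite c1.
  have -> : j = n by lia.
  by rewrite full // c1.
case: m mN => [|m] mN.
  have En : N = n by case: mN.
  split=> //=; [by rewrite sQ|by rewrite n0|].
  move=> r lt; have [s1 a1 c1] := base r lt; split=> // j jn.
  rewrite n0 c1 //; case: ltnP => lj; first by rewrite (minn_idPl _) //; lia.
  by rewrite (minn_idPr _) ?addn0 //; lia.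
rewrite iter_chi; split=> //=; first by rewrite size_set_nth sQ; lia.
  by rewrite n0.
move=> r lt; have [s1 a1 c1] := base r lt; rewrite nth_set_nth /= n0.
case: eqP => [E|ne]; last first.
  split=> // j jn; rewrite c1 //.
  case: ltnP => lj; first by rewrite (minn_idPl _) //; lia.
  by rewrite (minn_idPr _) ?muln0 ?addn0 //; lia.
rewrite -E -[n :: nseq m n]/(nseq m.+1 n); split.
- apply/(sortedP 0) => k; rewrite size_cat size_nseq => ltk.
  rewrite !nth_cat !nth_nseq; case: (ltnP k.+1) => l1.
    by rewrite (ltnW l1); apply: (sortedP 0 s1).
  rewrite [in X in _ <= X]ifT; last by lia.
  case: ltnP => l2; last by rewrite ifT; lia.
  by have := all_nthP 0 a1 k l2; lia.
- rewrite all_cat a1 andTb; apply/allP => y; rewrite mem_nseq => /andP[_ /eqP ->]; lia.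
- move=> j jn; rewrite count_cat count_nseq addnA c1 //.
  case: ltnP => lj; first by rewrite (minn_idPl _) ?addn0 //; lia.
  have -> : minn j n.-1 = r by lia.
  by rewrite ?eqxx ?mul1n ?muln1 /=.
Qed.

Section LastRow.

Variables (n : nat) (P0 : ypair).
Hypotheses (n0 : 0 < n) (skP : skew_pair P0) (bP : ballot (reading_word P0.2)).
Hypothesis szP : size P0.2 = n.

Let R := nth [::] P0.2 n.-1.
Let M := n.-1.
Let u := inner_bd P0 M.

(* The last row of T is moved to column 0 and replaced by its suffix W. *)
Definition tail_tle (W : seq nat) i r :=
  if r == n.-1 then count (fun y => y <= i) W else tle P0 i r.

Let hu m : hs (u m.+1) (u m) := hs_inner_bd M m (skew_inner_anti skP).

Let tle_n i r : n <= r -> tle P0 i r = 0.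
Proof. by move=> le; rewrite tle_out // szP. Qed.

Lemma tail_ut W : all (fun y => 0 < y) W -> u 0 =1 tail_tle W 0.
Proof.
move=> W0 r; rewrite /u /inner_bd /tail_tle subn0 /M; case: eqP => [->|ne].
  rewrite ltnn; apply/esym/eqP; rewrite eqn0Ngt -has_count -all_predC.
  by apply: sub_all W0 => y /=; lia.
rewrite -tle0 //; case: ltnP => // ge.
by rewrite tle_n //; lia.
Qed.

Section Suffix.

Variables W1 W : seq nat.
Hypothesis RE : R = W1 ++ W.

Let cW i : count (fun y => y <= i) W + nth 0 P0.1 n.-1 <= tle P0 i n.-1.
Proof. by rewrite /tle -/R RE count_cat; lia. Qed.

Lemma hs_tail i : hs (tail_tle W i) (tail_tle W i.+1).
Proof.
move=> r; have [h1 h2] := hs_tle skP i r; rewrite /tail_tle.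
have h3 := count_leqS i W.
split; first by case: eqP; lia.
case: eqP => [E1|n1]; case: eqP => [E2|n2] //; try lia.
- by have := cW i.+1; rewrite -E1; lia.
- by rewrite tle_n //; lia.
Qed.

(** Rows before the last are unchanged, and in the last row the suffix has at most as many letters i
    + 2 as [R], while the bound there only counts the rows above. *)
Lemma ballot3_tail i : ballot3 (tail_tle W i) (tail_tle W i.+1) (tail_tle W i.+2).
Proof.
have low j r : r <= n.-1 -> psum (tail_tle W j) r = psum (tle P0 j) r.
  move=> le; apply: eq_bigr => -[k /= lt] _; rewrite /tail_tle ifF //; lia.
have high j d : psum (tail_tle W j) (n + d) =
    psum (tle P0 j) n.-1 + count (fun y => y <= j) W.
  elim: d => [|d IH]; last first.
    by rewrite addnS psumS IH /tail_tle ifF ?tle_n ?addn0 //; lia.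
  by rewrite addn0 -(prednK n0) psumS low //= /tail_tle eqxx.
move=> r; have Bn := ballot3_tle skP bP i n.-1.
rewrite prednK // -[X in psum (tle P0 i.+2) X](prednK n0) in Bn.
rewrite -[X in _ <= psum (tle P0 i.+1) X + _](prednK n0) !psumS in Bn.
have cR j : tle P0 j.+1 n.-1 = tle P0 j n.-1 + count_mem j.+1 R.
  by rewrite /tle count_leqS addnA.
have cc j := count_leqS j W.
have le2 : count_mem i.+2 W <= count_mem i.+2 R by rewrite RE count_cat; lia.
have [lt|ge] := ltnP r.+1 n.
  by rewrite !low; try lia; apply: (ballot3_tle skP bP i r).
have Er : r.+1 = n + (r.+1 - n) by lia.
rewrite Er !high; have [E|ne] := eqVneq r n.-1.
  rewrite E !low //; have := cc i; have := cc i.+1; have := cR i.+1; lia.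
have Er' : r = n + (r - n) by lia.
rewrite Er' !high; have := cc i; have := cc i.+1; have := cR i.+1; lia.
Qed.

End Suffix.

(** These last lines interpolate between the result for the first n - 1 rows ([W] empty) and the
    result for the whole pair without the letters n of U ([W] equal to [R]). *)
Definition tail_g W j := grid u (tail_tle W) n (M - j).

Lemma all_suffix (a : pred nat) W1 W : all a (W1 ++ W) -> all a W.
Proof. by rewrite all_cat => /andP[]. Qed.

Let R_gt0 : all (fun y => 0 < y) R := skew_row_gt0 skP n.-1.
Let R_sorted : sorted leq R := skew_row_sorted skP n.-1.
Let R_le : all (fun y => y <= n) R.
Proof. by have := ballot_row_le skP bP n.-1; rewrite prednK. Qed.

Lemma tail_step W1 x W : R = W1 ++ x :: W -> exists s : nat -> nat,
  [/\ s 0 = x.-1, s M = n.-1,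
      forall j, j < M ->
        s j.+1 = s j + (tail_g W j (s j) < tail_g W j.+1 (s j))
    & forall j r, j <= M -> tail_g (x :: W) j r = tail_g W j r + (r == s j)].
Proof.
move=> RE; have RE' : R = (W1 ++ [:: x]) ++ W by rewrite -catA.
have gt0 : all (fun y => 0 < y) (x :: W) by apply: (@all_suffix _ W1); rewrite -RE.
have [x0 W0] := andP gt0.
have xn : x <= n by apply: (allP R_le); rewrite RE mem_cat mem_head orbT.
have ge : all (fun y => x <= y) W.
  have : sorted leq (x :: W).
    by move: R_sorted; rewrite RE sorted_cat_cons => /andP[_]; apply.
  by move/(order_path_min leq_trans).
have ht := hs_tail RE'; have ht' := hs_tail RE.
have ut := tail_ut W0; have ut' := tail_ut gt0.
have bt := ballot3_tail RE'; have bt' := ballot3_tail RE.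
have tE i k : tail_tle (x :: W) i k = tail_tle W i k + ((x <= i) && (k == n.-1)).
  by rewrite /tail_tle; case: eqP => _ /=; lia.
have tn i k : n <= k -> tail_tle W i k = 0.
  by move=> le; rewrite /tail_tle ifF ?tle_n //; lia.
have tx : tail_tle W x.-1 n.-1 = 0.
  rewrite /tail_tle eqxx; apply/eqP; rewrite eqn0Ngt -has_count -all_predC.
  by apply: sub_all ge => y /=; lia.
have uM : u M =1 (fun=> 0) by move=> k; rewrite /u /inner_bd subnn.
have add i := @grid_add_cell u _ _ n x hu ht ht' ut n0 x0 tE tn tx i.
have stab t' (h1 : forall i, hs (t' i) (t' i.+1)) (h2 : u 0 =1 t' 0)
    (h3 : forall i, ballot3 (t' i) (t' i.+1) (t' i.+2)) i k :
    k < i -> grid u t' i M k = grid u t' k.+1 M k.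
  move=> /subnK <-; elim: (i - k.+1) => // d IH.
  by rewrite addSn grid_stable //; lia.
have [s [s0 sR sE]] := add n xn.
have [q [q0 qR qE]] := add x (leqnn x).
(* In column [M] the cell of line x is above row x by [grid_low]; in a row before [x.-1] it would
   already be present on line [x.-1], where both grids agree. *)
have qx : q M = x.-1.
  have := qE M (q M); rewrite eqxx.
  have [lt|ge'] := ltnP (q M) x; last by rewrite grid_low //; lia.
  have [//|ne] := eqVneq (q M) x.-1.
  have k1 := @grid_stable u _ hu ht ut bt M x.-1 (q M).
  have k2 := @grid_stable u _ hu ht' ut' bt' M x.-1 (q M).
  rewrite prednK // in k1 k2; rewrite k1 ?k2; try lia.
  by rewrite (grid_before u tE) //; lia.
(* From line x on, row [x.-1] of column [M] is stable in both grids, so the cell is still there on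
   line [n]. *)
have sx : s M = x.-1.
  have xn' : x.-1 < n by rewrite prednK.
  have k1 := stab _ ht ut bt n x.-1 xn'; have k2 := stab _ ht' ut' bt' n x.-1 xn'.
  rewrite prednK // in k1 k2.
  have := sE M x.-1; rewrite k1 k2 qE qx eqxx.
  by case: (x.-1 =P s M) => //; lia.
exists (fun j => s (M - j)); split.
- by rewrite subn0.
- by rewrite subnn.
- by move=> j lt; rewrite /tail_g (sR (M - j.+1)) subnSK.
- by move=> j r jM; apply: sE.
Qed.

Lemma tail_g_nil j : tail_g [::] j n.-1 = 0.
Proof.
have ut := @tail_ut [::] isT; have ht := hs_tail (esym (cats0 R)).
apply/eqP; rewrite -leqn0.
apply: leq_trans (grid_le hu ht ut n n.-1 (leq0n (M - j))) _.
by rewrite (grid_t ut) /tail_tle eqxx.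
Qed.

Let Wlen (W : seq nat) := if W is [::] then n.-1 else n.

(** [sl] is the path of the latest added cell. Up to its row at value j, all cells of earlier routes
    lie inside the shape at j, and the next path stays weakly above [sl]; a new route cell is just
    outside that shape. For empty [W] the bound is the last row, whence the default [n] of
    [head]. *)
Lemma tail_induction P W1 W : R = W1 ++ W -> rep n.-1 M (tail_g [::]) P ->
  exists PW (sl : nat -> nat),
  [/\ phi_word W P = Some PW, rep (Wlen W) M (tail_g W) PW,
      [/\ size (phi_word_routes W P) = size W,
          pairwise disjoint_routes (phi_word_routes W P)
        & forall rt, rt \in phi_word_routes W P -> (last (0, 0) rt).1 = n.-1],
      forall rt r c, rt \in phi_word_routes W P -> (r, c) \in rt ->
        forall j, j <= M -> r <= sl j -> c < tail_g W j r
    & forall s : nat -> nat, s 0 <= (head n W).-1 -> s M = n.-1 ->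
        (forall j, j < M -> s j.+1 = s j + (tail_g W j (s j) < tail_g W j.+1 (s j))) ->
        forall j, j <= M -> s j <= sl j].
Proof.
move=> + repP; elim: W W1 => [|x W IH] W1 RE.
  exists P, (fun=> n.-1); split=> // s _ sM sR j jM; rewrite -sM.
  suff mono d : j + d <= M -> s j <= s (j + d) by have := mono (M - j); rewrite subnKC //; apply.
  elim: d => [|d IHd]; first by rewrite addn0.
  by rewrite addnS => le; rewrite sR //; apply: leq_trans (IHd (ltnW le)) (leq_addr _ _).
have RE' : R = (W1 ++ [:: x]) ++ W by rewrite -catA.
have [PW [sl [Ew repW [sz pw lst] bnd K]]] := IH _ RE'.
have [s [s0 sM sR gE]] := tail_step RE.
have gt0 : all (fun y => 0 < y) (x :: W) by apply: (@all_suffix _ W1); rewrite -RE.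
have [x0 W0] := andP gt0.
have xn : x <= n by apply: (allP R_le); rewrite RE mem_cat mem_head orbT.
have xW : x <= head n W.
  have : sorted leq (x :: W).
    by move: R_sorted; rewrite RE sorted_cat_cons => /andP[_]; apply.
  by case: (W) => [|y W'] //= /andP[].
have ht := hs_tail RE'; have ht' := hs_tail RE.
have ut := tail_ut W0; have ut' := tail_ut gt0.
have g_mono v j r : v <= j -> tail_g (x :: W) v r <= tail_g (x :: W) j r.
  by move=> vj; apply: grid_le => //; lia.
have [|||P' [rt [Ert rep' lrt spec]]] := phi_rep repW n0 x0 _ _ s0 sM sR gE.
- by rewrite /Wlen; case: (W) => [|? ?]; lia.
- by rewrite /Wlen; case: (W) => [|y W'] lt j; [apply: tail_g_nil|lia].
- move=> r; exact: hs_anti (hs_grid hu ht' ut' n (M - 0)).1 r.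
have s_sl j : j <= M -> s j <= sl j by apply: K => //; rewrite s0; lia.
exists P', s; rewrite /= Ew /= Ert /phi Ert /=; split=> //.
- split; first by rewrite sz.
  + rewrite pw andbT; apply/allP => rt0 rt0in; apply/hasPn => -[r c] c0.
    apply/negP => /spec [v [vM sv cE vmin]].
    (* The new cell is in the first column outside [tail_g W v] in its row, where the earlier routes
       have no cell. *)
    have := bnd rt0 r c rt0in c0 v vM; rewrite -cE ltnn => /(_ _) h.
    by have := h ltac:(by rewrite -sv; apply: s_sl).
  + by move=> rt0; rewrite inE => /orP[/eqP ->|/lst].
- move=> rt0 r c; rewrite inE => /orP[/eqP ->|rt0in].
    move=> /spec [v [vM sv cE vmin]] j jM rj.
    have vj : v <= j by rewrite leqNgt; apply/negP => /vmin; lia.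
    by apply: leq_trans (g_mono v j r vj); rewrite gE // sv eqxx cE addn1.
  move=> cin j jM rj; rewrite gE //.
  by have := bnd rt0 r c rt0in cin j jM (leq_trans rj (s_sl j jM)); lia.
- move=> s' s'0 s'M s'R; elim=> [|j IHj] jM; first by rewrite s0.
  have := IHj (ltnW jM); rewrite s'R // sR //.
  rewrite leq_eqVlt => /orP[/eqP E|]; last by lia.
  (* Where the paths meet, [s'] is tested on shapes enlarged along [s]: if [s] stays in the row,
     both shapes have gained a cell and [s'] stays as well. *)
  by rewrite E !gE // ?(ltnW jM) // eqxx sR //; case: ltnP => //; lia.
Qed.

(** * Comparing the grids of the whole and of the restricted pair *)

Let full_ut : inner_bd P0 n 0 =1 tle P0 0.
Proof.
move=> r; rewrite tle0 // /inner_bd subn0; case: ltnP => // ge.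
by rewrite skew_inner0 // szP.
Qed.

(* Sliding the letters n of U past the last row of T. *)
Lemma grid_first_column i :
  grid (inner_bd P0 n) (tle P0) i 1 =1 tail_tle R i.
Proof.
have hu' m : hs (inner_bd P0 n m.+1) (inner_bd P0 n m).
  by apply: hs_inner_bd; apply: skew_inner_anti.
have ut := full_ut.
have ht := hs_tle skP; elim: i => [|i IH] r.
  rewrite -(tail_ut R_gt0) /= /u /inner_bd subn0 /M.
  by rewrite subn1.
have h1 := (hs_grid hu' ht ut i 0).1; have h2 := (hs_grid hu' ht ut i 0).2.
have := togE h1 h2 r; rewrite -gridS IH !(grid_t ut) => E.
(* The minimum is always the length on line [i.+1]. The maximum differs from [tle P0 i] only in row
   [n.-1], where the cells of the letter n of U drop out. *)
have cap : capped (grid (inner_bd P0 n) (tle P0) i 1)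
    (grid (inner_bd P0 n) (tle P0) i.+1 0) r = tle P0 i.+1 r.
  rewrite /capped; case: (r) => [|k]; rewrite !(grid_t ut) // IH /tail_tle.
  have [_ h] := ht i k; apply/minn_idPl; case: eqP => // ek.
  by rewrite tle_n //; lia.
rewrite cap in E; have [h3 h4] := ht i r; move: E; rewrite /tail_tle.
case: eqP => [er|ne]; last by lia.
have -> : tle P0 i.+1 r.+1 = 0 by apply: tle_n; lia.
by rewrite /tle er -/R; lia.
Qed.

Lemma full_grid j r : j <= n.-1 ->
  grid (inner_bd P0 n) (tle P0) n (n - j) r = tail_g R j r.
Proof.
move=> jn; have -> : n - j = (M - j).+1 by rewrite /M; lia.
rewrite grid_shift; apply: eq_grid => [m k|i]; last exact: grid_first_column.
by rewrite /u /inner_bd /M; have -> : n - m.+1 = n.-1 - m by lia.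
Qed.

Lemma full_grid_last r : grid (inner_bd P0 n) (tle P0) n 0 r =
  tail_g R n.-1 r + nth 0 P0.1 n.-1 * (r == n.-1).
Proof.
rewrite (grid_t full_ut) /tail_g subnn (grid_t (tail_ut R_gt0)) /tail_tle.
by case: eqP => [->|_]; rewrite ?muln1 ?muln0 ?addn0 // /tle addnC.
Qed.

Lemma restrict_grid j r :
  grid (inner_bd (restrict n.-1 P0) M) (tle (restrict n.-1 P0)) n (M - j) r =
  tail_g [::] j r.
Proof.
apply: eq_grid => [m k|i k].
  rewrite /u /inner_bd; case: ltnP => // lt.
  by rewrite /= nth_take //; move: lt; rewrite /M; lia.
rewrite /tail_tle /tle /=; have [lt|ge] := ltnP k n.-1.
  by rewrite !nth_take // ifF //; lia.
have short (A : Type) (s : seq A) : size (take n.-1 s) <= k.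
  by rewrite size_take; case: ifP; lia.
rewrite (@nth_default _ 0 (take _ _)) // (@nth_default _ [::] (take _ _)) //.
by case: eqP => // ne; rewrite -/(tle P0 i k) tle_n //; lia.
Qed.

End LastRow.

Theorem mainTheorem3 (n : nat) (mu : seq nat) (T : seq (seq nat))
    (n_gt0 : 1 <= n) (LR_T : LR n (mu, T)) :
  let V := [seq x <- nth [::] T n.-1 | 0 < x < n] in
  let nu_n := count_mem n (flatten T) in
  let mu_n := nth 0 mu n.-1 in
  exists P P' Q : ypair,
    [/\ rho1 (restrict n.-1 (mu, T)) P,
        rho1 (mu, T) Q,
        iter nu_n (obind (phi n)) (Some P) = Some P',
        omap (iter mu_n (chi n)) (phi_word V P') = Some Q
      & let routes := phi_word_routes V P' in
        [/\ size routes = size V,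
            pairwise disjoint_routes routes
          & forall rt, rt \in routes -> (last (0, 0) rt).1 = n.-1]].
Proof.
move=> V nu_n mu_n; have [skP Tn bP] := LR_T; rewrite /= in Tn.
have row_le r y : y \in nth [::] T r -> y <= r.+1.
  by move=> yin; apply: (allP (ballot_row_le skP bP r)).
have no_n k : k < n -> count_mem n (flatten (take k T)) = 0.
  move=> kn; apply/eqP; rewrite eqn0Ngt -has_count has_pred1; apply/negP.
  move=> /flattenP [row /(nthP [::]) [r]]; rewrite size_take_min => lt <-.
  by rewrite nth_take; [move/row_le; lia|lia].
(* With fewer than n rows the restriction changes nothing, and there is neither a letter to insert
   nor one to append. *)
have [lt|ge] := ltnP (size T) n.
  have [Q [rQ _]] := rho1_grid skP bP Tn (leqnn (size mu)).
  have le : size mu <= size T by case: skP.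
  exists Q, Q, Q; rewrite /restrict /= !take_oversize; try lia.
  have E : nth [::] T n.-1 = [::] by rewrite nth_default //; lia.
  have -> : nu_n = 0 by rewrite /nu_n -(take_size T) no_n.
  have -> : mu_n = 0 by rewrite /mu_n nth_default //; lia.
  by rewrite /V E.
have szT : size T = n by lia.
have sk' := skew_restrict n.-1 skP; have b' := ballot_restrict n.-1 bP.
have sz' : size (take n.-1 T) = n.-1 by rewrite size_take szT ifT //; lia.
(* The restricted pair is also followed up to line [n], its last strip being empty, so that both
   grids end on the same line. *)
have [||P [rP repP]] := @rho1_grid _ n n.-1 sk' b'.
- by rewrite /= sz' leq_pred.
- by rewrite /= size_take_min geq_minl.
have [|Q [rQ repQ]] := rho1_grid skP bP Tn (_ : size (mu, T).1 <= n).
  by apply: leq_trans Tn; case: skP.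
rewrite [size (mu, T).2]szT in repQ.
have {}repP : rep n.-1 n.-1 (tail_g n (mu, T) [::]) P.
  move: repP; rewrite /= sz' => -[pa sP aE rows]; split=> // r => [|lt].
    by rewrite aE restrict_grid.
  have [s1 a1 c1] := rows r lt; split=> // j jM.
  by have := c1 j jM; rewrite !restrict_grid.
set R := nth [::] T n.-1.
(* All letters n of T lie in row n, at its end; as the rightmost letter acts first, inserting [R] is
   [phi n] repeated, then [V]. *)
have RE : R = V ++ nseq nu_n n.
  have -> : nu_n = count_mem n R.
    rewrite /nu_n -{1}(cat_take_drop n.-1 T) (drop_nth [::]) ?drop_oversize; try lia.
    by rewrite flatten_cat count_cat no_n /= ?cats0 //; lia.
  apply: sorted_split_max; first exact: (skew_row_sorted skP n.-1).
  apply/allP => y yin; have := row_le _ _ yin.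
  by have := allP (skew_row_gt0 skP n.-1) y yin; lia.
have [P' [sl [EP' repP' [szZ _ _] _ _]]] :=
  tail_induction n_gt0 skP bP szT RE repP.
have [PR [sl' [EPR repPR [szR pwR lstR] _ _]]] :=
  tail_induction n_gt0 skP bP szT (erefl : R = [::] ++ R) repP.
have EV : phi_word V P' = Some PR.
  by move: EPR; rewrite [in X in X -> _]RE phi_word_cat EP'.
have routesE : phi_word_routes R P = phi_word_routes V P' ++ phi_word_routes (nseq nu_n n) P.
  by rewrite RE (phi_word_routes_cat _ EP').
exists P, P', Q; split=> //.
- by rewrite -phi_word_nseq.
- rewrite EV /=; congr Some.
  (* Row n of the total shape is nonempty, so it is present after the insertions or is created by
     [chi n]. *)
  have muR : 0 < mu_n \/ R <> [::].
    case ER : R => [|y R']; [left|by right].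
    have := rowlen_gt0 skP (_ : n.-1 < size (mu, T).2).
    by rewrite /rowlen /= -/R ER addn0 szT; apply; lia.
  apply: rep_inj (@chi_rep _ n mu_n _ _ n_gt0 _ _ _ repPR) repQ _.
  - by case: (R) => [|? ?]; lia.
  - by case: (R) muR => [|? ?] [] // ?; [left|left|right].
  - by case: (R) => [|? ?] lt j; [apply: tail_g_nil|lia].
  - move=> j r jn; have [lt|gej] := ltnP j n; first by rewrite full_grid //; lia.
    have -> : j = n by lia.
    by rewrite subnn full_grid_last.
- split.
  + move: szR; rewrite routesE size_cat szZ RE size_cat; lia.
  + by move: pwR; rewrite routesE pairwise_cat => /and3P[].
  + by move=> rt rtin; apply: lstR; rewrite routesE mem_cat rtin.
Qed.
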